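(* The geodesic flow on $\mathcal{S}(KS_0)$ (in a given direction) is closed if and only if for every $n\ge 0$ the geodesic flow on $\mathcal{S}(KS_n)$ (in that direction) is closed. Moreover, for every $n\ge 0$, the set of directions for which the discrete billiard flow $f_n$ on $\Omega(KS_n)$ is closed (i.e. directions for which, regardless of the initial basepoint, a geodesic will be closed) is exactly the set of directions for which the billiard flow $f_0$ on $\Omega(KS_0)$ is closed.
   Context: Let $KS_0=\Delta$ be the equilateral triangle of side length $1$ with base $I=[0,1]$. For $n\ge 0$, $KS_{n+1}$ is obtained from the polygon $KS_n$ by removing the open middle third of each of its $3\cdot 4^n$ sides and replacing it by the two other sides of the equilateral triangle erected on it, pointing outward. $\Omega(KS_n)$ is the compact region bounded by $KS_n$. The flat surface $\mathcal{S}(KS_n)$ is $(\Omega(KS_n)\times D_3)/\sim$, where $D_3$ (of order $6$) is generated by the linear parts of the reflections in the sides, and $(p_1,r_1)\sim(p_2,r_2)$ iff $p_1=p_2$ and: (1) $r_1=r_2$; or (2) the point lies on a side $s_a$ and $r_1^{-1}r_2=r_a$, the linear part of the reflection in $s_a$; or (3) the point is a vertex with adjacent sides $s_a,s_b$ and $r_1^{-1}r_2$ lies in the subgroup generated by $r_a,r_b$. Its flat structure gives a well-defined notion of direction and of geodesic (straight-line) flow in each direction; vertices of the polygon give conic singularities of the surface. The billiard map $f_n$ on $(KS_n\times S^1)/\sim$ sends a boundary point with inward pointing direction $(x,\theta)$ to $(x^1,\theta^1)$, where $x^1$ is the first point of $KS_n$ hit by the ray from $x$ in direction $\theta$ and $\theta^1$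 is the inward direction obtained by reflecting $\theta$ in the side containing $x^1$. All directions are measured in a fixed coordinate system placed at the base of $KS_0$. The flow in a direction is closed if every trajectory in that direction, regardless of initial basepoint, is closed: for the billiard flow this means that the set of iterates under $f_n$ (Poincaré section) of every initial point is finite; trajectories running into singularities (vertices) are counted as closed when they form saddle connections (segments joining singularities). *)

(* Defs.v *)
From HB Require Import structures.
From mathcomp Require Import all_boot all_order all_algebra.
From mathcomp Require Import all_classical all_reals all_analysis.
Set Implicit Arguments.
Unset Strict Implicit.
Unset Printing Implicit Defensive.
Import Order.TTheory GRing.Theory Num.Theory.
Import numFieldNormedType.Exports.
Local Open Scope classical_set_scope.
Local Open Scope ring_scope.

Section KochSnowflake.
Context {R : realType}.
Implicit Types (n : nat) (p q u v w x y : 'cV[R]_2) (r : 'M[R]_2).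

Definition vec2 (a b : R) : 'cV[R]_2 := \col_(i < 2) (if i == ord0 then a else b).
Definition xc v : R := v ord0 ord0.
Definition yc v : R := v ord_max ord0.
Definition dot u v : R := (u^T *m v) ord0 ord0.

Definition unit_circle : set 'cV[R]_2 := [set v | dot v v = 1].

(** ** The polygons KS_n and the regions they bound *)

(* A polygon is given by the cyclic list of its oriented sides
   (start point, end point), listed counterclockwise.  The outward side is
   therefore always on the right, so the bump is erected by turning the middle
   third clockwise by 60 degrees. *)
Definition turn_right60 v : 'cV[R]_2 :=
  vec2 (xc v / 2 + Num.sqrt 3 / 2 * yc v) (yc v / 2 - Num.sqrt 3 / 2 * xc v).

Definition koch_replace (s : 'cV[R]_2 * 'cV[R]_2) : seq ('cV[R]_2 * 'cV[R]_2) :=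
  let third := 3^-1 *: (s.2 - s.1) in
  let a := s.1 + third in
  let apex := a + turn_right60 third in
  let b := a + third in
  [:: (s.1, a); (a, apex); (apex, b); (b, s.2)].

Fixpoint KS_sides n : seq ('cV[R]_2 * 'cV[R]_2) :=
  if n is m.+1 then flatten [seq koch_replace s | s <- KS_sides m]
  else let A := vec2 0 0 in let B := vec2 1 0 in
       let C := vec2 (1 / 2) (Num.sqrt 3 / 2) in
       [:: (A, B); (B, C); (C, A)].

Definition side_set (s : 'cV[R]_2 * 'cV[R]_2) : set 'cV[R]_2 :=
  [set p | exists2 t : R, 0 <= t <= 1 & p = s.1 + t *: (s.2 - s.1)].

Definition KS n : set 'cV[R]_2 :=
  [set p | exists2 s, s \in KS_sides n & side_set s p].

Definition KS_vertex n : set 'cV[R]_2 :=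
  [set p | exists2 s, s \in KS_sides n & p = s.1].

(* The curve together with the bounded components of its complement. *)
Definition Omega n : set 'cV[R]_2 :=
  [set p | KS n p \/ bounded_set (connected_component (~` KS n) p)].

(** ** The flat surface S(KS_n) *)

(* Linear part of the orthogonal reflection in the line carrying [s]. *)
Definition side_refl (s : 'cV[R]_2 * 'cV[R]_2) : 'M[R]_2 :=
  let d := s.2 - s.1 in (2 / dot d d) *: (d *m d^T) - 1%:M.

Inductive generated (S : set 'M[R]_2) : 'M[R]_2 -> Prop :=
| generated_one : generated S 1%:M
| generated_in r of S r : generated S r
| generated_mul r r' of generated S r & generated S r' : generated S (r *m r')
| generated_inv r of generated S r : generated S (invmx r).

Definition D3 n : set 'M[R]_2 :=
  generated [set r | exists2 s, s \in KS_sides n & r = side_refl s].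

(* Points of S(KS_n) are represented by pairs in Omega(KS_n) x D_3, taken up to
   [surface_eq]. *)
Definition surface_pt n (z : 'cV[R]_2 * 'M[R]_2) : Prop :=
  Omega n z.1 /\ D3 n z.2.

Definition surface_eq n (z1 z2 : 'cV[R]_2 * 'M[R]_2) : Prop :=
  z1.1 = z2.1 /\
  [\/ z1.2 = z2.2,
      exists s, [/\ s \in KS_sides n, side_set s z1.1 &
                    invmx z1.2 *m z2.2 = side_refl s]
    | exists s s', [/\ s \in KS_sides n, s' \in KS_sides n,
                       s.2 = z1.1, s'.1 = z1.1 &
         generated [set side_refl s; side_refl s'] (invmx z1.2 *m z2.2)]].

(* The flat charts: the copy of Omega(KS_n) of index r is developed into the
   plane by r, and around the class of (p, g) the copies which meet there have
   the common coordinate r (q - p).  [flat_disp n z v z'] says that z' has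
   coordinate v in the chart centred at z.  For the copy r = 1 directions are
   those of the plane of the polygon; in the copy r the direction v is seen in
   the polygon as r^-1 v. *)
Definition flat_disp n (z : 'cV[R]_2 * 'M[R]_2) v (z' : 'cV[R]_2 * 'M[R]_2) :=
  exists r, [/\ D3 n r, surface_eq n z (z.1, r), surface_eq n z' (z'.1, r) &
                r *m (z'.1 - z.1) = v].

(* [c] is, over the times in [J], a unit speed geodesic in the direction [v]. *)
Definition geodesic n v (J : set R) (c : R -> 'cV[R]_2 * 'M[R]_2) : Prop :=
  forall t, J t -> surface_pt n (c t) /\
    exists2 e : R, 0 < e & forall s, J s -> `|s - t| < e ->
      flat_disp n (c t) ((s - t) *: v) (c s).

Definition periodic_geodesic n v (c : R -> 'cV[R]_2 * 'M[R]_2) : Prop :=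
  [/\ geodesic n v setT c,
      forall t, ~ KS_vertex n (c t).1 &
      exists2 T : R, 0 < T & forall t, surface_eq n (c (t + T)) (c t)].

Definition saddle_connection n v (a b : R) (c : R -> 'cV[R]_2 * 'M[R]_2) : Prop :=
  [/\ geodesic n v `[a, b] c,
      KS_vertex n (c a).1, KS_vertex n (c b).1 &
      forall t, a < t < b -> ~ KS_vertex n (c t).1].

(* The initial datum (p, r) is required to be the representative in which the
   trajectory starts off, i.e. r^-1 v does not leave the region at p.  Every
   nonsingular point of the surface has such a representative; the point is the
   start of several trajectories only when it is singular, and then each of
   them is obtained from such a representative. *)
Definition geodesic_flow_closed n v : Prop :=
  forall p r, surface_pt n (p, r) ->
  (\forall t \near 0^'+, Omega n (p + t *: (invmx r *m v))) ->
  exists c : R -> 'cV[R]_2 * 'M[R]_2,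
    [/\ surface_eq n (c 0) (p, r),
        \forall t \near 0^'+, surface_eq n (c t) (p + t *: (invmx r *m v), r) &
        periodic_geodesic n v c \/
        exists a b : R, a <= 0 < b /\ saddle_connection n v a b c].

(** ** The billiard map f_n *)

Definition inward n x v : Prop :=
  \forall t \near 0^'+, (Omega n `\` KS n) (x + t *: v).

Definition first_hit n x v y : Prop :=
  exists t : R, [/\ 0 < t, y = x + t *: v, KS n y &
                    forall s, 0 < s < t -> ~ KS n (x + s *: v)].

(* The graph of f_n, on the inward representatives of the classes of
   (KS_n x S^1)/~; f_n is not defined when the ray first meets KS_n at a
   vertex. *)
Definition billiard_map n (z z' : 'cV[R]_2 * 'cV[R]_2) : Prop :=
  [/\ KS n z.1, inward n z.1 z.2, first_hit n z.1 z.2 z'.1,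
      ~ KS_vertex n z'.1 &
      exists s, [/\ s \in KS_sides n, side_set s z'.1 &
                    z'.2 = side_refl s *m z.2]].

Definition finite_orbit n (z : 'cV[R]_2 * 'cV[R]_2) : Prop :=
  exists o : nat -> 'cV[R]_2 * 'cV[R]_2,
    [/\ o 0%N = z, forall k, billiard_map n (o k) (o k.+1) &
        finite_set (range o)].

(* The trajectory of [z] starts at a vertex (time 0), passes through [z] (time
   j) and, from its m-th state, runs into a vertex. *)
Definition billiard_saddle n (z : 'cV[R]_2 * 'cV[R]_2) : Prop :=
  exists (m j : nat) (o : nat -> 'cV[R]_2 * 'cV[R]_2),
    [/\ (j <= m)%N /\ o j = z,
        KS_vertex n (o 0%N).1,
        forall k, (k < m)%N -> billiard_map n (o k) (o k.+1) &
        exists2 y, first_hit n (o m).1 (o m).2 y & KS_vertex n y].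

Definition billiard_closed n v : Prop :=
  forall x, KS n x -> inward n x v ->
  finite_orbit n (x, v) \/ billiard_saddle n (x, v).

End KochSnowflake.

(* Main.v *)
Require Import Defs.
From mathcomp Require Import all_boot all_order all_algebra.
From mathcomp Require Import all_classical all_reals all_analysis.
From mathcomp Require Import ring lra zify.

(** All sides of KS_n are edges of the triangular lattice L_n of mesh 3^-n, and
    L_0 is contained in L_n.  For each n, either of the two flows is closed in
    the direction v if and only if v is rational, meaning that some non zero
    multiple of v is in L_0.  As this condition does not depend on n, both
    assertions follow.

    Closed directions are rational.  The reflections in the sides preserve
    L_n, so that the point r p modulo L_n depends only on the class of (p, r)
    on the surface ([surface_eq_unfold]): unfolding maps the surface to the
    torus of L_n, and the flow to the linear flow v ([geodesic_unfold],
    [billiard_unfolds]).  A trajectory that is periodic, or that joins two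
    vertices (which are sent to 0), shows that T v is in L_n for some T > 0.
    An orbit of the billiard map that closes up may do so in another sheet of
    the surface; iterating the loop brings it back ([unfolds_loop]).  Some trajectory does exist, because the region bounded by KS_n has a
    non empty interior ([Omega_interior]).

    Rational directions are closed.  Consider the states (x, r), where x is on
    KS_n and r^-1 v points inwards at x; the bounce of the billiard ball is an
    injective partial map on states, undefined only where the ray runs into a
    vertex, and whose image misses only states at vertices.  When l is a
    lattice vector parallel to v, the area cross (r x) l is, along an orbit,
    constant modulo a fixed k > 0, and only finitely many states have such an
    area ([level_set_finite]).  A partial injection of a finite set has no
    other orbits than cycles and chains from a source to a sink
    ([partial_bijection_orbits]): the trajectory is periodic or joins two
    vertices ([orbit_dichotomy]).  Flights between bounces are then glued into
    geodesics ([orbit_geodesic]); trajectories along a side are saddle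
    connections by themselves ([side_saddle]).

    The dynamics uses little of the shape of the region: a segment which
    avoids KS_n stays in its component ([Omega_move]), a ray which starts
    inside hits KS_n ([first_hit_ex]), and near a point that is not a vertex
    KS_n is contained in a line ([near_dir]), so that a reflected ray enters
    the component the incoming ray came from ([inward_mirror]). *)

Set Implicit Arguments.
Unset Strict Implicit.
Unset Printing Implicit Defensive.
Import Order.TTheory GRing.Theory Num.Theory.
Import numFieldNormedType.Exports.
Local Open Scope classical_set_scope.
Local Open Scope ring_scope.

(** * Plane vectors, reflections and the triangular lattice *)

Section PlaneLattice.
Context {R : realType}.
Implicit Types (n : nat) (p q u v w x y : 'cV[R]_2) (g r : 'M[R]_2).
Implicit Types (s : 'cV[R]_2 * 'cV[R]_2) (h k : int * int).

Lemma vec_ext u w : xc u = xc w -> yc u = yc w -> u = w.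
Proof.
move=> hx hy; apply/matrixP => i j; rewrite [j]ord1.
by case: i => [[|[|//]] i2]; [move: hx|move: hy]; rewrite /xc /yc;
   congr (_ = _); congr (_ _ _); apply: val_inj.
Qed.

Lemma xcD u w : xc (u + w) = xc u + xc w. Proof. by rewrite /xc mxE. Qed.
Lemma ycD u w : yc (u + w) = yc u + yc w. Proof. by rewrite /yc mxE. Qed.
Lemma xcN u : xc (- u) = - xc u. Proof. by rewrite /xc mxE. Qed.
Lemma ycN u : yc (- u) = - yc u. Proof. by rewrite /yc mxE. Qed.
Lemma xcZ a u : xc (a *: u) = a * xc u. Proof. by rewrite /xc mxE. Qed.
Lemma ycZ a u : yc (a *: u) = a * yc u. Proof. by rewrite /yc mxE. Qed.
Lemma xc0 : xc (0 : 'cV[R]_2) = 0. Proof. by rewrite /xc mxE. Qed.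
Lemma yc0 : yc (0 : 'cV[R]_2) = 0. Proof. by rewrite /yc mxE. Qed.
Lemma xc_vec (a b : R) : xc (vec2 a b) = a. Proof. by rewrite /xc mxE. Qed.
Lemma yc_vec (a b : R) : yc (vec2 a b) = b. Proof. by rewrite /yc mxE. Qed.
Definition cE := (xcD, ycD, xcN, ycN, xcZ, ycZ, xc0, yc0, xc_vec, yc_vec).

Lemma dotE u w : dot u w = xc u * xc w + yc u * yc w.
Proof.
rewrite /dot mxE !big_ord_recl big_ord0 addr0 !mxE /xc /yc.
by congr (_ + _ * _); congr (_ _ _); apply: val_inj.
Qed.

Definition cross u w : R := xc u * yc w - yc u * xc w.

Lemma crossDl u u' w : cross (u + u') w = cross u w + cross u' w.
Proof. by rewrite /cross !cE; ring. Qed.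
Lemma crossDr u w w' : cross u (w + w') = cross u w + cross u w'.
Proof. by rewrite /cross !cE; ring. Qed.
Lemma crossNl u w : cross (- u) w = - cross u w.
Proof. by rewrite /cross !cE; ring. Qed.
Lemma crossNr u w : cross u (- w) = - cross u w.
Proof. by rewrite /cross !cE; ring. Qed.
Lemma crossZl a u w : cross (a *: u) w = a * cross u w.
Proof. by rewrite /cross !cE; ring. Qed.
Lemma crossZr a u w : cross u (a *: w) = a * cross u w.
Proof. by rewrite /cross !cE; ring. Qed.
Lemma crossvv u : cross u u = 0.
Proof. by rewrite /cross; ring. Qed.

(** Cramer's rule in the plane. *)
Lemma cross_basis u w p :
  cross u w *: p = cross p w *: u + cross u p *: w.
Proof. by apply: vec_ext; rewrite !cE /cross; ring. Qed.

Lemma dot_gt0 u : u != 0 -> 0 < dot u u.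
Proof.
move=> u0; rewrite dotE -!expr2 lt0r addr_ge0 ?sqr_ge0 // andbT.
rewrite paddr_eq0 ?sqr_ge0 // !sqrf_eq0.
apply: contra u0 => /andP[/eqP hx /eqP hy].
by apply/eqP/vec_ext; rewrite !cE.
Qed.

Lemma cross0_par u w : u != 0 -> cross u w = 0 -> exists c, w = c *: u.
Proof.
move=> u0 c0; have d0 := dot_gt0 u0.
exists (dot u w / dot u u).
have hE : dot u u *: w = dot u w *: u.
  apply: vec_ext; rewrite !cE !dotE; move: c0; rewrite /cross => c0.
    transitivity (xc u * (xc u * xc w + yc u * yc w) - yc u * (xc u * yc w - yc u * xc w)); first by ring.
    by rewrite c0; ring.
  transitivity (yc u * (xc u * xc w + yc u * yc w) + xc u * (xc u * yc w - yc u * xc w)); first by ring.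
  by rewrite c0; ring.
by rewrite mulrC -scalerA -hE scalerA mulVf ?scale1r // gt_eqF.
Qed.

Lemma side_reflE s w : let d := s.2 - s.1 in
  side_refl s *m w = (2 * dot d w / dot d d) *: d - w.
Proof.
rewrite /= /side_refl; set d := s.2 - s.1.
rewrite mulmxBl mul1mx -scalemxAl -mulmxA.
rewrite [d^T *m w]mx11_scalar mul_mx_scalar scalerA; congr (_ *: _ - _).
by rewrite -/(dot d w) mulrAC.
Qed.

Lemma mulmx_ext g r : (forall w : 'cV[R]_2, g *m w = r *m w) -> g = r.
Proof.
move=> h; apply/matrixP => i j.
have := h (delta_mx j ord0); rewrite -!colE => /matrixP/(_ i ord0).
by rewrite !mxE.
Qed.

Lemma side_refl_invol s : s.2 != s.1 -> side_refl s *m side_refl s = 1%:M.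
Proof.
move=> s0; apply: mulmx_ext => w; rewrite mul1mx -mulmxA !side_reflE.
set d := s.2 - s.1; have d0 : 0 < dot d d by rewrite dot_gt0 // subr_eq0.
have dD a b c : dot d (a *: b - c) = a * dot d b - dot d c by rewrite !dotE !cE; ring.
rewrite dD opprB addrA [_ + w]addrC -addrA -scalerBl.
set c := (X in X *: _); suff -> : c = 0 by rewrite scale0r addr0.
by rewrite /c; field; rewrite gt_eqF.
Qed.

Lemma side_refl_unit s : s.2 != s.1 -> side_refl s \in unitmx.
Proof. by move/side_refl_invol => /mulmx1_unit[]. Qed.

Lemma side_refl_inv s : s.2 != s.1 -> invmx (side_refl s) = side_refl s.
Proof.
move=> s0; have U := side_refl_unit s0.
by rewrite -[RHS](mulKmx U) side_refl_invol // mulmx1.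
Qed.

Lemma side_refl_par s s' (c : R) : c != 0 -> s'.2 - s'.1 = c *: (s.2 - s.1) ->
  side_refl s' = side_refl s.
Proof.
move=> c0 E; case: (eqVneq (s.2 - s.1) 0) => [d0|d0].
  by rewrite /side_refl E d0 scaler0.
apply: mulmx_ext => w; rewrite !side_reflE E; set d := s.2 - s.1 in d0 *.
have := dot_gt0 d0 => d1; congr (_ - _); rewrite scalerA; congr (_ *: _).
have -> : dot (c *: d) w = c * dot d w by rewrite !dotE !cE; ring.
have -> : dot (c *: d) (c *: d) = c * c * dot d d by rewrite !dotE !cE; ring.
by field; rewrite gt_eqF.
Qed.

Lemma cross_refl s w :
  cross (s.2 - s.1) (side_refl s *m w) = - cross (s.2 - s.1) w.
Proof. by rewrite side_reflE crossDr crossZr crossvv mulr0 add0r crossNr. Qed.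

(** The affine reflection in the line of s fixes its points, and differs from
    its linear part by a translation. *)
Lemma refl_on_side s p : s.2 != s.1 -> side_set s p ->
  side_refl s *m p - p = side_refl s *m s.1 - s.1.
Proof.
move=> s0 [t _ ->]; rewrite !side_reflE; set d := s.2 - s.1.
have d0 : 0 < dot d d by rewrite dot_gt0 // subr_eq0.
have -> : dot d (s.1 + t *: d) = dot d s.1 + t * dot d d by rewrite !dotE !cE; ring.
have -> : 2 * (dot d s.1 + t * dot d d) / dot d d = 2 * dot d s.1 / dot d d + 2 * t.
  by field; rewrite gt_eqF.
by apply: vec_ext; rewrite !cE; ring.
Qed.

Definition rho : R := Num.sqrt 3 / 2.
Lemma rho2 : rho * rho = 3 / 4.
Proof.
rewrite /rho; have : Num.sqrt 3 ^+ 2 = 3 :> R by rewrite sqr_sqrtr.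
by rewrite expr2 => h; lra.
Qed.
Lemma rho_gt0 : 0 < rho.
Proof. by rewrite /rho divr_gt0 // sqrtr_gt0. Qed.

(** The element a + b e^(i pi/3) of the Eisenstein lattice. *)
Definition lv (a b : int) : 'cV[R]_2 := vec2 (a%:~R + b%:~R / 2) (b%:~R * rho).

Lemma lvD a b c d : lv a b + lv c d = lv (a + c) (b + d).
Proof. by apply: vec_ext; rewrite /lv !cE !intrD; field. Qed.
Lemma lvN a b : - lv a b = lv (- a) (- b).
Proof. by apply: vec_ext; rewrite /lv !cE !mulrNz; field. Qed.
Lemma lvZ (c a b : int) : c%:~R *: lv a b = lv (c * a) (c * b).
Proof. by apply: vec_ext; rewrite /lv !cE !intrM; field. Qed.
Lemma cross_lv a b c d : cross (lv a b) (lv c d) = rho * (a * d - b * c)%:~R.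
Proof. by rewrite /cross /lv !cE !rmorphB !rmorphM /=; field. Qed.
Lemma dot_lv a b c d : 2 * dot (lv a b) (lv c d) = (2 * a * c + 2 * b * d + a * d + b * c)%:~R.
Proof.
rewrite dotE /lv !cE mulrDr.
have -> : 2 * (b%:~R * rho * (d%:~R * rho)) = 2 * (b%:~R * d%:~R) * (rho * rho) by ring.
by rewrite rho2 !rmorphD !rmorphM /=; field.
Qed.
Lemma turn_right60_lv a b : turn_right60 (lv a b) = lv (a + b) (- a).
Proof.
apply: vec_ext; rewrite /turn_right60 /lv -/rho !cE ?rmorphD rmorphN /=.
  by rewrite mulrCA rho2; field.
by field.
Qed.

(** The six units of the lattice, in the coordinates of [lv]. *)
Definition hex : seq (int * int) :=
  [:: (1, 0); (0, 1); (-1, 1); (-1, 0); (0, -1); (1, -1)].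
Definition lvp h := lv h.1 h.2.

Definition turnR h : int * int := (h.1 + h.2, - h.1).
Definition turnL h : int * int := (- h.2, h.1 + h.2).
Lemma hexR h : h \in hex -> turnR h \in hex.
Proof. by rewrite !inE; do 6?[case/orP]; move/eqP->. Qed.
Lemma hexL h : h \in hex -> turnL h \in hex.
Proof. by rewrite !inE; do 6?[case/orP]; move/eqP->. Qed.

Lemma hex_dot h : h \in hex -> dot (lvp h) (lvp h) = 1.
Proof.
move=> hh; have : 2 * dot (lvp h) (lvp h) = 2.
  by rewrite dot_lv; move: hh; rewrite !inE; do 6?[case/orP]; move/eqP->.
by move=> ?; lra.
Qed.
Lemma hex_neq0 h : h \in hex -> lvp h != 0.
Proof.
move=> hh; apply/eqP => E; have := hex_dot hh.
by rewrite E dotE !cE mul0r addr0 => /esym/eqP; rewrite oner_eq0.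
Qed.

(** Two units which are not parallel span a fundamental parallelogram. *)
Lemma hex_cross h k : h \in hex -> k \in hex ->
  [\/ lvp k = lvp h, lvp k = - lvp h, cross (lvp h) (lvp k) = rho | cross (lvp h) (lvp k) = - rho].
Proof.
move=> hh kk; rewrite /lvp lvN cross_lv.
have : [\/ k = h, k = (- h.1, - h.2), h.1 * k.2 - h.2 * k.1 = 1 | h.1 * k.2 - h.2 * k.1 = -1].
  move: hh kk; rewrite !inE; do 6?[case/orP]; move/eqP->; do 6?[case/orP]; move/eqP->;
   do ?[by constructor 1|by constructor 2|by constructor 3|by constructor 4].
case=> E; [constructor 1|constructor 2|constructor 3|constructor 4]; rewrite E //=.
  by rewrite mulr1.
by rewrite rmorphN1 mulrN1.
Qed.

(** The linear reflection in the line of the unit h; the coefficient c, twice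
    the scalar product of h and k, is an integer. *)
Definition hexrefl h k : int * int :=
  let c := 2 * h.1 * k.1 + 2 * h.2 * k.2 + h.1 * k.2 + h.2 * k.1 in
  (c * h.1 - k.1, c * h.2 - k.2).
Lemma hexreflP h k : h \in hex -> k \in hex -> hexrefl h k \in hex.
Proof.
by rewrite !inE; do 6?[case/orP]; move/eqP->; do 6?[case/orP]; move/eqP->.
Qed.

Lemma pow3_neq0 n : 3 ^+ n != 0 :> R. Proof. by rewrite expf_neq0. Qed.
Lemma pow3_gt0 n : 0 < 3 ^+ n :> R. Proof. by rewrite exprn_gt0. Qed.

Definition lat n : set 'cV[R]_2 :=
  [set p | exists a b, 3 ^+ n *: p = lv a b].

Lemma latD n p q : lat n p -> lat n q -> lat n (p + q).
Proof.
by move=> [a [b E]] [c [d F]]; exists (a + c), (b + d); rewrite scalerDr E F lvD.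
Qed.
Lemma latN n p : lat n p -> lat n (- p).
Proof. by move=> [a [b E]]; exists (- a), (- b); rewrite scalerN E lvN. Qed.
Lemma latB n p q : lat n p -> lat n q -> lat n (p - q).
Proof. by move=> ? /latN; apply: latD. Qed.
Lemma lat0 n : lat n 0.
Proof. by exists 0, 0; rewrite scaler0; apply: vec_ext; rewrite /lv !cE; field. Qed.
Lemma latS n p : lat n p -> lat n.+1 p.
Proof.
move=> [a [b E]]; exists (3 * a), (3 * b).
by rewrite exprS -scalerA E -lvZ.
Qed.
Lemma lat_ge n p : lat 0 p -> lat n p.
Proof. by move=> L; elim: n => // n /latS. Qed.

Lemma lat_cross n p q : lat n p -> lat n q ->
  exists m : int, cross p q = m%:~R * (rho / (3 ^+ n * 3 ^+ n)).
Proof.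
move=> [a [b E]] [c [d F]]; exists (a * d - b * c).
have := cross_lv a b c d; rewrite -E -F crossZl crossZr => {}E.
have := pow3_neq0 n; move: (3 ^+ n) E => t E t0.
transitivity (t * (t * cross p q) / (t * t)); first by field.
by rewrite E; field.
Qed.

(** Units that are not parallel form a basis of the lattice, and by Cramer's
    rule the two areas are the coordinates of p in this basis. *)
Lemma lat_cross_inv n h k p : h \in hex -> k \in hex ->
  cross (lvp h) (lvp k) != 0 ->
  (exists m : int, 3 ^+ n * cross (lvp h) p = rho * m%:~R) ->
  (exists m : int, 3 ^+ n * cross (lvp k) p = rho * m%:~R) -> lat n p.
Proof.
move=> hh kk c0 [m E] [m' F].
have B : cross (lvp h) (lvp k) *: (3 ^+ n *: p) = rho *: (- (m'%:~R *: lvp h) + m%:~R *: lvp k).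
  rewrite cross_basis !crossZr crossZl E [cross p _](_ : _ = - cross (lvp k) p); last by rewrite /cross; ring.
  by rewrite mulrN F scalerDr !scalerA scalerN scalerA scaleNr.
suff [e eE] : exists e : int, 3 ^+ n *: p = e%:~R *: (- (m'%:~R *: lvp h) + m%:~R *: lvp k).
  by rewrite /lat /= eE /lvp !lvZ lvN lvD lvZ; do 2 eexists.
have r0 : rho != 0 by rewrite gt_eqF // rho_gt0.
case: (hex_cross hh kk) => C; move: c0 B; rewrite C ?crossNr ?crossvv ?oppr0 ?eqxx // => _ B.
  by exists 1; rewrite scale1r; move: B => /(scalerI r0).
exists (-1); rewrite scaleN1r; move: B; rewrite scaleNr -scalerN => /(scalerI r0) <-.
by rewrite opprK.
Qed.

Definition edge n s := lat n s.1 /\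
  exists2 h, h \in hex & 3 ^+ n *: (s.2 - s.1) = lvp h.

Lemma edge_neq n s : edge n s -> s.2 != s.1.
Proof.
move=> [_ [h hh E]]; apply/eqP => e; have := hex_neq0 hh.
by rewrite -E e subrr scaler0 eqxx.
Qed.

Lemma edge_dir n s : edge n s -> exists2 h, h \in hex & s.2 - s.1 = (3 ^+ n)^-1 *: lvp h.
Proof.
move=> [_ [h hh E]]; exists h => //.
by rewrite -E scalerA mulVf ?scale1r // pow3_neq0.
Qed.

Lemma lat_hex n h : h \in hex -> lat n ((3 ^+ n)^-1 *: lvp h).
Proof.
by move=> hh; exists h.1, h.2; rewrite scalerA mulfV ?scale1r // pow3_neq0.
Qed.

Lemma edge_lat2 n s : edge n s -> lat n s.2.
Proof.
move=> es; have [h hh E] := edge_dir es.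
by rewrite -[s.2](subrK s.1) E; apply: latD (lat_hex _ hh) _; case: es.
Qed.

(** The area is constant along the line of s, and s.1 is a lattice point. *)
Lemma edge_cross n s p : edge n s -> side_set s p -> forall h, h \in hex ->
  3 ^+ n *: (s.2 - s.1) = lvp h ->
  exists m : int, 3 ^+ n * cross (lvp h) p = rho * m%:~R.
Proof.
move=> [[a [b L]] _] [t _ ->] h hh E.
exists (h.1 * b - h.2 * a); rewrite -cross_lv -L crossZr crossDr crossZr.
have -> : cross (lvp h) (s.2 - s.1) = 0 by rewrite -E crossZl crossvv mulr0.
by rewrite mulr0 addr0.
Qed.

(** Otherwise the point would be on two lattice lines of different
    directions, hence in the lattice. *)
Lemma edge_meet n s s' p : edge n s -> edge n s' -> side_set s p ->
  side_set s' p -> ~ lat n p -> exists2 c : R, c != 0 & s'.2 - s'.1 = c *: (s.2 - s.1).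
Proof.
move=> es es' sp sp' np.
have [_ [h hh E]] := es; have [_ [h' hh' E']] := es'.
have [C|C] := eqVneq (cross (lvp h) (lvp h')) 0; last first.
  by case: np; apply: (lat_cross_inv hh hh' C); [exact: edge_cross E|exact: edge_cross E'].
have r0 := rho_gt0.
have I : injective ( *:%R (3 ^+ n : R) : 'cV[R]_2 -> 'cV[R]_2) by apply: scalerI; rewrite pow3_neq0.
case: (hex_cross hh hh') => F; first last.
- by move: C; rewrite F => /eqP; rewrite oppr_eq0 gt_eqF.
- by move: C; rewrite F => /eqP; rewrite gt_eqF.
- by exists (-1); rewrite ?oppr_eq0 ?oner_eq0 // scaleN1r; apply: I; rewrite /= scalerN E E'.
- by exists 1; rewrite ?oner_eq0 // scale1r; apply: I; rewrite /= E E'.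
Qed.

(** The units are primitive vectors of the lattice. *)
Lemma edge_inner n s (t : R) : edge n s -> lat n (s.1 + t *: (s.2 - s.1)) ->
  exists m : int, t = m%:~R.
Proof.
move=> [L [h hh E]] L'.
have {}L' : lat n (t *: (s.2 - s.1)) by have := latB L' L; rewrite [s.1 + _]addrC addrK.
have : cross (lvp h) (lvp (turnL h)) = rho.
  by rewrite cross_lv; move: hh; rewrite !inE; do 6?[case/orP]; move/eqP->; rewrite /= ?mulr1.
case: L' => a [b F] C; exists (a * (turnL h).2 - b * (turnL h).1).
have r0 : rho != 0 by rewrite gt_eqF // rho_gt0.
apply: (mulfI r0); rewrite -cross_lv -F scalerA [3 ^+ n * t]mulrC -scalerA E crossZl.
by rewrite -/(lvp (turnL h)) C mulrC.
Qed.

Lemma edge_inner01 n s (t : R) : edge n s -> 0 < t < 1 -> ~ lat n (s.1 + t *: (s.2 - s.1)).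
Proof.
move=> es /andP[t0 t1] /(edge_inner es)[m mE]; move: t0 t1.
rewrite mE ltr0z (ltrz1 R m) => m0 m1; lia.
Qed.

Definition hexmap g := forall h, h \in hex -> exists2 k, k \in hex & g *m lvp h = lvp k.
(** The linear symmetries of the lattice.  Asking for the inverse as well
    makes the closure under the operations of [generated] immediate. *)
Definition hexsym g := [/\ g \in unitmx, hexmap g & hexmap (invmx g)].

Lemma hexmap_lat n g p : hexmap g -> lat n p -> lat n (g *m p).
Proof.
move=> hg [a [b E]].
have [k1 _ E1] := hg (1, 0) isT; have [k2 _ E2] := hg (0, 1) isT.
have -> : g *m p = (3 ^+ n)^-1 *: (g *m (3 ^+ n *: p)).
  by rewrite -scalemxAr scalerA mulVf ?scale1r // pow3_neq0.
have -> : 3 ^+ n *: p = a%:~R *: lvp (1,0) + b%:~R *: lvp (0,1).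
  by rewrite E !lvZ lvD /= !mulr1 !mulr0 addr0 add0r.
rewrite mulmxDr -!scalemxAr E1 E2 !lvZ lvD.
by do 2 eexists; rewrite scalerA mulfV ?scale1r ?pow3_neq0.
Qed.

Lemma hexsym1 : hexsym 1%:M.
Proof.
split; first exact: unitmx1; last rewrite invmx1;
by move=> h hh; exists h => //; rewrite mul1mx.
Qed.

Lemma hexmapM g r : hexmap g -> hexmap r -> hexmap (g *m r).
Proof.
move=> G H h /H[k /G[l ll E] F]; exists l => //.
by rewrite -mulmxA F.
Qed.

Lemma invmxM g r : g \in unitmx -> r \in unitmx -> invmx (g *m r) = invmx r *m invmx g.
Proof.
move=> gU rU; have grU : g *m r \in unitmx by rewrite unitmx_mul gU.
by rewrite -[RHS](mulKmx grU) -[g *m r *m _]mulmxA mulKVmx // mulmxV // mulmx1.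
Qed.

Lemma hexsymM g r : hexsym g -> hexsym r -> hexsym (g *m r).
Proof.
move=> [gU G G'] [rU H H']; split; first by rewrite unitmx_mul gU.
  exact: hexmapM.
by rewrite invmxM //; apply: hexmapM.
Qed.

Lemma hexsymV g : hexsym g -> hexsym (invmx g).
Proof. by move=> [gU G G']; split; rewrite ?unitmx_inv ?invmxK. Qed.

Lemma hexsym_refl n s : edge n s -> hexsym (side_refl s).
Proof.
move=> es; have s0 := edge_neq es; have [_ [h hh E]] := es.
suff H : hexmap (side_refl s) by split; rewrite ?side_refl_inv ?side_refl_unit.
rewrite -(@side_refl_par s (0, lvp h) (3 ^+ n)) ?pow3_neq0 ?subr0 //= => k kk.
exists (hexrefl h k); first exact: hexreflP.
rewrite side_reflE /= subr0 hex_dot // divr1 dot_lv lvZ lvN lvD.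
by rewrite /lvp /hexrefl.
Qed.

Lemma hexsym_gen (S : set 'M[R]_2) g : (forall r, S r -> hexsym r) ->
  generated S g -> hexsym g.
Proof.
move=> HS; elim=> [|r|r r' _ Hr _ Hr'|r _ Hr].
- exact: hexsym1. - exact: HS. - exact: hexsymM. - exact: hexsymV.
Qed.

(** A linear map is determined by the images of two independent units. *)
Lemma hexsym_finite : finite_set [set g | hexsym g].
Proof.
pose f g := (g *m lvp (1,0), g *m lvp (0,1)).
pose H := [set` [seq lvp h | h <- hex]].
have fI : injective f.
  move=> g r [E1 E2]; apply: mulmx_ext => w.
  have -> : w = (xc w - yc w / (2 * rho)) *: lvp (1,0) + (yc w / rho) *: lvp (0,1).
    have := rho_gt0 => r0.
    by apply: vec_ext; rewrite /lvp /lv /= !cE; field; rewrite ?gt_eqF.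
  by rewrite !mulmxDr -!scalemxAr E1 E2.
have /(finite_preimage (in2W fI)) : finite_set (H `*` H).
  by apply: finite_setX; apply: finite_seq.
have HP k : k \in hex -> H (lvp k) by move=> kk; apply: map_f.
apply: sub_finite_set => g [gU G _].
split; first by have [//|k /HP kk E] := G (1, 0); rewrite /f E.
by have [//|k /HP kk E] := G (0, 1); rewrite /f E.
Qed.

End PlaneLattice.

(** * The polygons and the components of their complement *)

Section Polygon.
Context {R : realType}.
Implicit Types (n : nat) (p q u v w x y : 'cV[R]_2) (g r : 'M[R]_2).
Implicit Types (s : 'cV[R]_2 * 'cV[R]_2) (h k : int * int).

Lemma addlK p w : p + w - p = w.
Proof. by rewrite addrC addKr. Qed.

Lemma turnD u w : turn_right60 (u + w) = turn_right60 u + turn_right60 w.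
Proof. by apply: vec_ext; rewrite /turn_right60 !cE; ring. Qed.
Lemma turnZ (a : R) u : turn_right60 (a *: u) = a *: turn_right60 u.
Proof. by apply: vec_ext; rewrite /turn_right60 !cE; ring. Qed.
Lemma turn_turn u : turn_right60 (turn_right60 u) = turn_right60 u - u.
Proof.
apply: vec_ext; rewrite /turn_right60 -/rho !cE.
  by rewrite mulrBr (mulrCA rho rho) (mulrA rho rho) rho2; field.
by rewrite mulrDr (mulrA rho rho) rho2; field.
Qed.
Lemma cross_turn u : cross u (turn_right60 u) = - rho * dot u u.
Proof. by rewrite /cross dotE /turn_right60 -/rho !cE; field. Qed.

Lemma koch_edge n s s' : edge n s -> s' \in koch_replace s -> edge n.+1 s'.
Proof.
move=> es; have [_ [h hh E]] := es; have [L _] := es.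
rewrite /koch_replace; set t := 3^-1 *: (s.2 - s.1).
have Et : 3 ^+ n.+1 *: t = lvp h.
  by rewrite exprSr scalerA -mulrA mulfV // mulr1.
have ET : 3 ^+ n.+1 *: turn_right60 t = lvp (turnR h).
  by rewrite -turnZ Et turn_right60_lv.
have Lt : lat n.+1 t by rewrite /lat /= Et; do 2 eexists.
have LT : lat n.+1 (turn_right60 t) by rewrite /lat /= ET; do 2 eexists.
have L1 := latS L; have La := latD L1 Lt; have Lp := latD La LT.
have Lb := latD La Lt.
rewrite !inE => /or4P[] /eqP-> /=; split=> //=.
- by exists h => //; rewrite addrC addKr.
- by exists (turnR h); rewrite ?hexR // [s.1 + t + _]addrC addrK.
- exists (turnL h); rewrite ?hexL //.
  rewrite opprD addrACA subrr add0r scalerBr Et ET /lvp lvN lvD.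
  by congr (lv _ _); rewrite /=; ring.
- exists h => //; rewrite -Et; congr (_ *: _).
  by apply: vec_ext; rewrite /t !cE; field.
Qed.

Lemma sides_edge n s : s \in KS_sides n -> edge n s.
Proof.
elim: n s => [|n IH] s; last first.
  move=> /flatten_mapP[s0 /IH]; exact: koch_edge.
have e1 : vec2 1 0 = lv 1 0 :> 'cV[R]_2 by apply: vec_ext; rewrite /lv !cE; field.
have e2 : vec2 (1 / 2) (Num.sqrt 3 / 2) = lv 0 1 :> 'cV[R]_2.
  by apply: vec_ext; rewrite /lv -/rho !cE; field.
have e0 : vec2 0 0 = lv 0 0 :> 'cV[R]_2 by apply: vec_ext; rewrite /lv !cE; field.
rewrite /= e0 e1 e2 !inE => /or3P[] /eqP->; (split; [by rewrite /lat /= expr0 scale1r; do 2 eexists|]);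
rewrite /= expr0 scale1r lvN lvD; [exists (1, 0)|exists (-1, 1)|exists (0, -1)] => //.
Qed.

Lemma sides_next n s : s \in KS_sides n ->
  exists2 s', s' \in KS_sides n & s'.1 = s.2.
Proof.
elim: n s => [|n IH] s.
  rewrite /=; set A := vec2 0 0; set B := vec2 1 0; set C := vec2 (1 / 2) _.
  rewrite !inE => /or3P[] /eqP-> /=.
  - by exists (B, C); rewrite ?inE ?eqxx ?orbT.
  - by exists (C, A); rewrite ?inE ?eqxx ?orbT.
  - by exists (A, B); rewrite ?inE ?eqxx ?orbT.
move=> /flatten_mapP[s0 s0S].
have mem s' : s' \in koch_replace s0 -> s' \in KS_sides n.+1.
  by move=> sS'; apply/flatten_mapP; exists s0.
move: mem; rewrite /koch_replace; set t := 3^-1 *: _; set a := s0.1 + t.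
set c := a + _; set b := a + t => mem.
rewrite !inE => /or4P[] /eqP-> /=.
- by exists (a, c) => //; apply: mem; rewrite !inE eqxx orbT.
- by exists (c, b) => //; apply: mem; rewrite !inE eqxx !orbT.
- by exists (b, s0.2) => //; apply: mem; rewrite !inE eqxx !orbT.
- have [s1 s1S <-] := IH _ s0S.
  exists (s1.1, s1.1 + 3^-1 *: (s1.2 - s1.1)) => //.
  by apply/flatten_mapP; exists s1 => //; rewrite /koch_replace !inE eqxx.
Qed.

Lemma side_vertex n s : s \in KS_sides n -> KS_vertex n s.1 /\ KS_vertex n s.2.
Proof. by move=> sS; split; [exists s|have [s' ? <-] := sides_next sS; exists s']. Qed.

Lemma vertex_lat n p : KS_vertex n p -> lat n p.
Proof. by move=> [s /sides_edge[L _] ->]. Qed.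

Lemma side_end1 s : side_set s s.1.
Proof. by exists 0; rewrite ?lexx ?ler01 // scale0r addr0. Qed.

Lemma vertex_KS n p : KS_vertex n p -> KS n p.
Proof. by move=> [s sS ->]; exists s => //; apply: side_end1. Qed.

(** The end points of a side are vertices because the sides of the polygon
    follow each other cyclically ([sides_next]). *)
Lemma side_inner n s p : s \in KS_sides n -> side_set s p -> ~ KS_vertex n p ->
  exists2 t : R, 0 < t < 1 & p = s.1 + t *: (s.2 - s.1).
Proof.
move=> sS [t /andP[t0 t1] E] nv; exists t => //.
have [V1 V2] := side_vertex sS.
apply/andP; split.
  rewrite lt_neqAle t0 andbT; apply/eqP => t00; apply: nv.
  by rewrite E -t00 scale0r addr0.
rewrite lt_neqAle t1 andbT; apply/eqP => t00; apply: nv.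
by rewrite E t00 scale1r addrC subrK.
Qed.

Lemma nonvertex_lat n s p : s \in KS_sides n -> side_set s p -> ~ KS_vertex n p ->
  ~ lat n p.
Proof.
move=> sS sp nv; have [t t01 ->] := side_inner sS sp nv.
by apply: edge_inner01 => //; apply: sides_edge.
Qed.

Lemma D3_hexsym n g : D3 n g -> hexsym g.
Proof.
apply: hexsym_gen => r [s sS ->]; exact: hexsym_refl (sides_edge sS).
Qed.

Lemma near0P (P : R -> Prop) :
  (\forall t \near 0^'+, P t) <-> exists2 e : R, 0 < e & forall t, 0 < t < e -> P t.
Proof.
split.
  move=> [e /= e0 H]; exists e => // t /andP[t0 te]; apply: H => //=.
  by rewrite sub0r normrN gtr0_norm.
move=> [e e0 H]; exists e => //= t /=; rewrite sub0r normrN => te t0.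
by apply: H; rewrite t0 /= -(gtr0_norm t0).
Qed.

Lemma near0_ex2 (P Q : R -> Prop) : (\forall t \near 0^'+, P t) ->
  (\forall t \near 0^'+, Q t) -> exists t, [/\ 0 < t, P t & Q t].
Proof.
move=> /near0P[e e0 He] /near0P[f f0 Hf]; exists (Num.min e f / 2).
have m0 : 0 < Num.min e f by rewrite lt_min e0.
have : Num.min e f <= e /\ Num.min e f <= f by rewrite !ge_min !lexx orbT.
by move=> [me mf]; split; [|apply: He|apply: Hf]; lra.
Qed.

Lemma line_continuous x v : continuous (fun t : R => x + t *: v).
Proof.
move=> t; apply: cvgD; first exact: cvg_cst.
by apply: cvgZr_tmp; apply: cvg_id.
Qed.

Lemma xc_continuous : continuous (@xc R).
Proof. by move=> x; apply: coord_continuous. Qed.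
Lemma yc_continuous : continuous (@yc R).
Proof. by move=> x; apply: coord_continuous. Qed.

Lemma crossl_continuous a b : continuous (fun q => cross (q - a) b).
Proof.
have -> : (fun q => cross (q - a) b) = (fun q => xc q * yc b - yc q * xc b - cross a b).
  by apply/funext => q; rewrite /cross !cE; ring.
move=> q.
have Hx : xc x * yc b @[x --> q] --> xc q * yc b.
  exact: (@cvgM _ _ _ _ (@xc R) (fun=> yc b) (xc q) (yc b) (@xc_continuous q) (cvg_cst _)).
have Hy : yc x * xc b @[x --> q] --> yc q * xc b.
  exact: (@cvgM _ _ _ _ (@yc R) (fun=> xc b) (yc q) (xc b) (@yc_continuous q) (cvg_cst _)).
pose proof (cvgB (cvgB Hx Hy) (cvg_cst (cross a b))) as H.
exact H.
Qed.

Lemma crossr_continuous a b : continuous (fun q => cross b (q - a)).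
Proof.
have -> : (fun q => cross b (q - a)) = (fun q => cross (q - a) (- b)).
  by apply/funext => q; rewrite /cross !cE; ring.
exact: crossl_continuous.
Qed.

Lemma side_set_closed s : closed (side_set s).
Proof.
apply: compact_closed; first exact: norm_hausdorff.
have -> : side_set s = [set s.1 + t *: (s.2 - s.1) | t in `[0, 1]%classic].
  apply/seteqP; split=> p [t t01]; last by move=> <-; exists t.
  by move=> ->; exists t.
apply: continuous_compact; last exact: segment_compact.
by apply: continuous_subspaceT; apply: line_continuous.
Qed.

Lemma KS_closed n : closed (@KS R n).
Proof.
apply: (@closed_bigcup _ _ [set` KS_sides n] (fun s => side_set s)).
  exact: finite_seq.
by move=> s _; apply: side_set_closed.
Qed.

Lemma bounded_setP (A : set 'cV[R]_2) : bounded_set A <->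
  exists M : R, forall x, A x -> `|x| <= M.
Proof.
split.
  move=> [M [_ H]]; exists (M + 1) => x Ax; apply: (H (M + 1)) => //.
  by rewrite ltrDl.
by move=> [M H]; exists M; split; [exact: num_real|move=> z Mz x Ax; apply: le_trans (H _ Ax) (ltW Mz)].
Qed.

Definition seg p q : set 'cV[R]_2 := [set p + t *: (q - p) | t in `[0, 1]%classic].

Lemma seg_connected p q : connected (seg p q).
Proof.
apply: connected_continuous_connected; first exact: segment_connected.
by apply: continuous_subspaceT; apply: line_continuous.
Qed.

Lemma Omega_segment n p q : Omega n p -> (forall t : R, 0 <= t <= 1 -> ~ KS n (p + t *: (q - p))) ->
  connected_component (~` KS n) p q.
Proof.
move=> Op H.
have sp : seg p q p by exists 0; rewrite ?scale0r ?addr0 //= in_itv /= lexx ler01.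
have sq : seg p q q by exists 1; rewrite ?scale1r ?(addrC p) ?subrK //= in_itv /= lexx ler01.
apply: (connected_component_max sp _ (seg_connected (p := p) (q := q)) sq).
by move=> _ [t /= t01 <-]; apply: H; rewrite in_itv /= in t01.
Qed.

Lemma Omega_move n p q : Omega n p -> (forall t : R, 0 <= t <= 1 -> ~ KS n (p + t *: (q - p))) ->
  (Omega n `\` KS n) q.
Proof.
move=> Op H; have C := Omega_segment Op H.
split; last by have := H 1; rewrite scale1r addrC subrK; apply; rewrite lexx ler01.
case: Op => [Kp|B]; first by case: (H 0); rewrite ?lexx ?ler01 // scale0r addr0.
by right; rewrite -(same_connected_component C).
Qed.

Lemma Omega_ray n p u (t : R) : 0 <= t -> Omega n p ->
  (forall t' : R, 0 <= t' <= t -> ~ KS n (p + t' *: u)) ->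
  (Omega n `\` KS n) (p + t *: u).
Proof.
move=> t0 Op H; apply: Omega_move Op _ => t' /andP[t'0 t'1].
rewrite addlK scalerA; apply: H.
by rewrite mulr_ge0 //= ler_piMl.
Qed.

(** A ray which avoids KS_n would stay in the component of its starting point,
    which is bounded. *)
Lemma ray_hits n p u : u != 0 -> Omega n p -> exists2 t : R, 0 <= t & KS n (p + t *: u).
Proof.
move=> u0 Op; apply: contrapT => N.
have H (t : R) : 0 <= t -> ~ KS n (p + t *: u) by move=> t0 K; apply: N; exists t.
case: (Op) => [K|/bounded_setP[M B]].
  by apply: (H 0) => //; rewrite scale0r addr0.
have n0 : 0 < `|u| by rewrite normr_gt0.
(* at this time the ray is at a distance greater than M from the origin *)
pose t := (`|M| + `|p| + 1) / `|u|.
have t0 : 0 <= t by rewrite divr_ge0 // !addr_ge0.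
have /B : connected_component (~` KS n) p (p + t *: u).
  apply: Omega_segment Op _ => t' /andP[t'0 _].
  by rewrite addlK scalerA; apply: H; rewrite mulr_ge0.
apply/negP; rewrite -ltNge.
have := ler_normB (p + t *: u) p; rewrite addlK normrZ (ger0_norm t0).
rewrite {1}/t divfK ?gt_eqF // => Hn; have := ler_norm M; move: Hn; lra.
Qed.

(** By [ray_hits] the times at which the ray is on KS_n form a non empty set,
    which contains its infimum since KS_n is closed. *)
Lemma first_hit_ex n p u : u != 0 -> (Omega n `\` KS n) p ->
  exists t : R, [/\ 0 < t, KS n (p + t *: u) &
     forall t', 0 <= t' < t -> (Omega n `\` KS n) (p + t' *: u)].
Proof.
move=> u0 [Op nK]; pose S := [set t : R | 0 <= t /\ KS n (p + t *: u)].
have [t1 t10 Kt1] := ray_hits u0 Op.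
have S0 : has_inf S by split; [exists t1|exists 0 => t []].
have i0 : 0 <= inf S by apply: lb_le_inf; [exists t1|move=> t []].
have iK : KS n (p + inf S *: u).
  apply: contrapT => N.
  have : \forall t \near inf S, (~` KS n) (p + t *: u).
    apply: (@line_continuous p u (inf S)).
    by apply: open_nbhs_nbhs; split; [rewrite openC; exact: KS_closed|].
  move=> [e /= e0 He]; have [t [t0 Kt] te] := inf_adherent e0 S0.
  apply: (He t) => //=; rewrite distrC ger0_norm ?subr_ge0; first by rewrite ltrBlDl.
  by apply: ge_inf; [exact: S0.2|].
have ipos : 0 < inf S.
  rewrite lt_neqAle i0 andbT; apply/eqP => e; apply: nK.
  by move: iK; rewrite -e scale0r addr0.
exists (inf S); split=> // t' /andP[t'0 t'i].
apply: Omega_ray => // t'' /andP[a b] K.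
have : inf S <= t'' by apply: ge_inf; [exact: S0.2|].
by apply/negP; rewrite -ltNge (le_lt_trans b).
Qed.

Lemma near_KS n p : ~ KS n p -> \forall q \near p, ~ KS n q.
Proof.
move=> N; apply: (@open_nbhs_nbhs _ p (~` KS n)); split => //.
by rewrite openC; apply: KS_closed.
Qed.

Lemma near_sides n p : \forall q \near p, forall s, s \in KS_sides n -> side_set s q -> side_set s p.
Proof.
elim: (KS_sides n) => [|s S IH]; first by near=> q.
have : \forall q \near p, side_set s q -> side_set s p.
  case: (pselect (side_set s p)) => [sp|N]; first by near=> q.
  have : nbhs p (~` side_set s).
    by apply: open_nbhs_nbhs; split; [rewrite openC; exact: side_set_closed|].
  by apply: filterS => q Nq /Nq.
move: IH; apply: filterS2 => q IH Hs s'; rewrite inE => /predU1P[->//|]; exact: IH.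
Unshelve. all: by end_near. Qed.

Lemma line_near x v (P : set 'cV[R]_2) : (\forall q \near x, P q) ->
  \forall t \near 0^'+, P (x + t *: v).
Proof.
move=> H; have L : x + t *: v @[t --> 0^'+] --> x.
  apply: cvg_at_right_filter.
  have E : x + 0 *: v = x by rewrite scale0r addr0.
  rewrite -[X in _ --> X]E; exact: line_continuous.
exact: (L _ H).
Qed.

(** The sides met by a small ball around p all contain p, and are parallel by
    [edge_meet]. *)
Lemma near_dir n s p : s \in KS_sides n -> side_set s p -> ~ KS_vertex n p ->
  \forall q \near p, KS n q -> cross (s.2 - s.1) (q - p) = 0.
Proof.
move=> sS sp nv; apply: filterS (near_sides n p) => q H [s' s'S s'q].
have s'p := H _ s'S s'q.
have [c c0 E] := edge_meet (sides_edge sS) (sides_edge s'S) sp s'p (nonvertex_lat sS sp nv).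
suff : cross (s'.2 - s'.1) (q - p) = 0.
  by rewrite E crossZl => /eqP; rewrite mulf_eq0 (negPf c0) => /eqP.
case: s'q => t _ ->; case: s'p => t' _ ->.
by rewrite opprD addrACA subrr add0r -scalerBl crossZr crossvv mulr0.
Qed.

Lemma inner_near n s p w (c : R) : s \in KS_sides n -> side_set s p -> ~ KS_vertex n p ->
  w = c *: (s.2 - s.1) -> \forall t \near 0^'+, side_set s (p + t *: w).
Proof.
move=> sS sp nv ->; have [t /andP[t0 t1] E] := side_inner sS sp nv.
apply/near0P; have c1 : 0 < `|c| + 1 by rewrite ltr_wpDl.
exists (Num.min t (1 - t) / (`|c| + 1)).
  by rewrite divr_gt0 // lt_min t0 subr_gt0.
move=> e /andP[e0]; rewrite ltr_pdivlMr // lt_min => /andP[et et1].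
exists (t + e * c); last by rewrite E scalerDl scalerA addrA.
have : `|e * c| <= e * (`|c| + 1).
  by rewrite normrM (gtr0_norm e0) ler_pM2l // lerDl.
rewrite ler_norml => /andP[b1 b2]; apply/andP; split; lra.
Qed.

(** A ray in the direction of the side starts along the side. *)
Lemma inward_transverse n s y w : s \in KS_sides n -> side_set s y -> ~ KS_vertex n y ->
  inward n y w -> cross (s.2 - s.1) w != 0.
Proof.
move=> sS sy nv Iw; apply/eqP => c0.
have d0 : s.2 - s.1 != 0 by rewrite subr_eq0; exact: edge_neq (sides_edge sS).
have [c E] := cross0_par d0 c0.
have := inner_near sS sy nv E; move: Iw; rewrite /inward => A B.
have [t [_ [_ K] S]] := near0_ex2 A B.
by apply: K; exists s.
Qed.

(** The segment that joins a point of a short ray to its mirror image in the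
    normal of the side is parallel to the side and off its line; as KS_n is near
    y contained in this line, both points are in the same component.  This is
    what makes a reflected ray point inwards whenever the reversed incoming ray
    does. *)
Lemma inward_mirror n s y w : s \in KS_sides n -> side_set s y -> ~ KS_vertex n y ->
  inward n y w -> inward n y (- (side_refl s *m w)).
Proof.
move=> sS sy nv Iw; have c0 := inward_transverse sS sy nv Iw.
set w' := - _.
have cw' : cross (s.2 - s.1) w' = cross (s.2 - s.1) w.
  by rewrite /w' crossNr cross_refl opprK.
have /nbhs_ballP[e /= e0 He] := near_dir sS sy nv.
move: Iw => /near0P[e1 e10 H1]; apply/near0P.
(* M t bounds the distance to y of the segment considered *)
pose M := `|w| + `|w'| + 1; have M0 : 0 < M by rewrite /M ltr_wpDl // addr_ge0.
exists (Num.min e1 (e / M)); first by rewrite lt_min e10 divr_gt0.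
move=> t /andP[t0]; rewrite lt_min => /andP[te1 teM].
have [Oq2 nKq] := H1 t (introT andP (conj t0 te1)).
apply: Omega_move Oq2 _ => l /andP[l0 l1] K.
set q := y + t *: w + _ in K.
have qE : q - y = t *: ((1 - l) *: w + l *: w').
  by apply: vec_ext; rewrite /q !cE; ring.
have : cross (s.2 - s.1) (q - y) = 0.
  apply: He => //=; rewrite -ball_normE /= distrC qE normrZ (gtr0_norm t0).
  rewrite ltr_pdivlMr // in teM; apply: le_lt_trans teM.
  rewrite ler_pM2l //; apply: (le_trans (ler_normD _ _)).
  rewrite !normrZ (ger0_norm l0) ger0_norm ?subr_ge0 //.
  rewrite /M; have := normr_ge0 w; have := normr_ge0 w' => a b.
  have : (1 - l) * `|w| <= `|w| by rewrite ler_piMl // lerBlDl lerDr.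
  have : l * `|w'| <= `|w'| by rewrite ler_piMl.
  by move=> *; lra.
rewrite qE crossZr crossDr !crossZr cw' -mulrDl subrK mul1r => /eqP.
by rewrite mulf_eq0 gt_eqF //= (negPf c0).
Qed.

End Polygon.

(** * The region bounded by the polygon has interior points *)

Section Region.
Context {R : realType}.
Implicit Types (n : nat) (p q u v w x y : 'cV[R]_2) (g r : 'M[R]_2).
Implicit Types (s : 'cV[R]_2 * 'cV[R]_2) (S : seq ('cV[R]_2 * 'cV[R]_2)).

Definition left60 v : 'cV[R]_2 := v - turn_right60 v.

(** The equilateral triangle erected on the left of s, that is on the inner side,
    in barycentric coordinates scaled by twice its area. *)
Definition tri s : set 'cV[R]_2 :=
  let d := s.2 - s.1 in
  [set p | [/\ 0 <= cross (p - s.1) (left60 d), 0 <= cross d (p - s.1) &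
     cross (p - s.1) (left60 d) + cross d (p - s.1) <= cross d (left60 d)]].

Lemma cross_left60 v : cross v (left60 v) = rho * dot v v.
Proof. by rewrite /left60 crossDr crossNr crossvv cross_turn; ring. Qed.

Lemma edge_cross_gt0 n s : edge n s -> 0 < cross (s.2 - s.1) (left60 (s.2 - s.1)).
Proof.
by move=> es; rewrite cross_left60 mulr_gt0 ?rho_gt0 // dot_gt0 // subr_eq0 (edge_neq es).
Qed.

Lemma tri_closed s : closed (tri s).
Proof.
set d := s.2 - s.1; set l := left60 d.
have -> : tri s = (fun p => cross (p - s.1) l) @^-1` [set x | 0 <= x] `&`
   ((fun p => cross d (p - s.1)) @^-1` [set x | 0 <= x] `&`
    (fun p => cross (p - s.1) (l - d)) @^-1` [set x | x <= cross d l]).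
  apply/seteqP; split=> p; rewrite /tri /= -/d -/l.
    move=> [a b c]; split=> //; split=> //; move: c; congr (_ <= _).
    by rewrite /cross !cE; ring.
  move=> [a [b c]]; split=> //; move: c; congr (_ <= _).
  by rewrite /cross !cE; ring.
apply: closedI; [|apply: closedI]; (apply: closed_comp;
  [by move=> p _; try exact: crossl_continuous; exact: crossr_continuous|]).
- exact: closed_ge.
- exact: closed_ge.
- exact: closed_le.
Qed.

Lemma tri_frontier s p : 0 < cross (s.2 - s.1) (left60 (s.2 - s.1)) -> tri s p ->
  let c := s.1 + left60 (s.2 - s.1) in
  (\forall q \near p, tri s q) \/
  [\/ side_set s p, side_set (s.2, c) p | side_set (c, s.1) p].
Proof.
rewrite /tri /= -/(left60 _); set d := s.2 - s.1; set l := left60 d; set D := cross d l.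
move=> D0 [a0 b0 ab].
have Dn : D != 0 by rewrite gt_eqF.
have key : p = s.1 + (cross (p - s.1) l / D) *: d + (cross d (p - s.1) / D) *: l.
  have := cross_basis d l (p - s.1); rewrite -/D => E.
  apply/eqP; rewrite -addrA addrC -subr_eq; apply/eqP.
  apply: (scalerI Dn); rewrite E [RHS]scalerDr !scalerA.
  by rewrite !(mulrC D) !divfK.
have Ca := @crossl_continuous R s.1 l p.
have Cb := @crossr_continuous R s.1 d p.
have Cc := @crossl_continuous R s.1 (l - d) p.
set A := cross (p - s.1) l in a0 ab key *; set B := cross d (p - s.1) in b0 ab key *.
have [A0|An] := eqVneq A 0.
  right; constructor 3; exists (1 - B / D).
    have : 0 <= B / D by rewrite divr_ge0 ?(ltW D0).
    have : B / D <= 1 by rewrite ler_pdivrMr //; lra.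
    by move=> *; apply/andP; split; lra.
  by rewrite [LHS]key A0; apply: vec_ext; rewrite /= !cE; ring.
have [B0|Bn] := eqVneq B 0.
  right; constructor 1; exists (A / D).
    by rewrite divr_ge0 ?(ltW D0) //= ler_pdivrMr //; lra.
  by rewrite [LHS]key B0 mul0r scale0r addr0.
have [AB|ABn] := eqVneq (A + B) D.
  right; constructor 2; exists (B / D).
    by rewrite divr_ge0 ?(ltW D0) //= ler_pdivrMr //; lra.
  rewrite [LHS]key (_ : A = D - B); last by rewrite -AB addrK.
  rewrite mulrBl divff //= (_ : s.2 = s.1 + d); last by rewrite /d addrC subrK.
  by apply: vec_ext; rewrite !cE; ring.
left.
have hA : 0 < A by rewrite lt_neqAle eq_sym An.
have hB : 0 < B by rewrite lt_neqAle eq_sym Bn.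
have hAB : cross (p - s.1) (l - d) < D.
  rewrite (_ : cross _ _ = A + B); first by rewrite lt_neqAle ABn.
  by rewrite /A /B /cross !cE; ring.
have Fa : \forall q \near p, 0 < cross (q - s.1) l by apply: (cvgr_gt _ Ca _ hA).
have Fb : \forall q \near p, 0 < cross d (q - s.1) by apply: (cvgr_gt _ Cb _ hB).
have Fc : \forall q \near p, cross (q - s.1) (l - d) < D by apply: (cvgr_lt _ Cc _ hAB).
apply: filterS3 Fa Fb Fc => q q2 q3 q1; split; [exact: ltW|exact: ltW|].
apply: le_trans (ltW q1); rewrite le_eqVlt; apply/orP; left; apply/eqP.
by rewrite /cross !cE; ring.
Qed.

(** The second side in [koch_replace s]: the triangle on its left is the
    equilateral triangle erected on the middle third of s. *)
Definition bump s : 'cV[R]_2 * 'cV[R]_2 :=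
  let t := 3^-1 *: (s.2 - s.1) in (s.1 + t, s.1 + t + turn_right60 t).

Lemma left60Z (a : R) v : left60 (a *: v) = a *: left60 v.
Proof. by rewrite /left60 turnZ scalerBr. Qed.
Lemma left60_turn v : left60 (turn_right60 v) = v.
Proof. by rewrite /left60 turn_turn opprB addrC subrK. Qed.

Lemma turn_left60 v : turn_right60 (left60 v) = v.
Proof. by rewrite /left60 turnD -scaleN1r turnZ scaleN1r turn_turn opprB addrC subrK. Qed.
Lemma left60_left60 v : left60 (left60 v) = - turn_right60 v.
Proof. by rewrite {1}/left60 turn_left60 /left60 addrC addKr. Qed.

(** The triangle on the left of s and the bump are on the two sides of the
    line of s, and share the middle third. *)
Lemma middle_interior s p (t : R) : 0 < cross (s.2 - s.1) (left60 (s.2 - s.1)) ->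
  p = s.1 + t *: (s.2 - s.1) -> 3^-1 < t < 2 / 3 ->
  \forall q \near p, tri s q \/ tri (bump s) q.
Proof.
set d := s.2 - s.1; set l := left60 d; set D := cross d l.
move=> D0 pE /andP[t1 t2].
have Ca := @crossl_continuous R s.1 l p.
have Cc := @crossl_continuous R s.1 (l - d) p.
have EA : cross (p - s.1) l = t * D by rewrite pE addlK crossZl.
have EB : cross (p - s.1) (l - d) = t * D.
  by rewrite pE addlK crossZl crossDr crossNr crossvv subr0.
have tD1 : D / 3 < t * D by rewrite mulrC ltr_pM2r.
have tD2 : t * D < 2 / 3 * D by rewrite ltr_pM2r.
have tD3 : t * D < D by apply: lt_trans tD2 _; rewrite -[X in _ < X]mul1r ltr_pM2r //; lra.
have h1 : D / 3 < cross (p - s.1) l by rewrite EA.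
have h2 : cross (p - s.1) l < 2 / 3 * D by rewrite EA.
have h3 : D / 3 < cross (p - s.1) (l - d) by rewrite EB.
have h4 : cross (p - s.1) (l - d) < D by rewrite EB.
have F1 : \forall q \near p, D / 3 < cross (q - s.1) l by apply: (cvgr_gt _ Ca _ h1).
have F2 : \forall q \near p, cross (q - s.1) l < 2 / 3 * D by apply: (cvgr_lt _ Ca _ h2).
have F3 : \forall q \near p, D / 3 < cross (q - s.1) (l - d) by apply: (cvgr_gt _ Cc _ h3).
have F4 : \forall q \near p, cross (q - s.1) (l - d) < D by apply: (cvgr_lt _ Cc _ h4).
apply: filterS2 (filterI F1 F2) (filterI F3 F4) => q [q1 q2] [q3 q4].
set A := cross (q - s.1) l in q1 q2.
have EAB : cross (q - s.1) (l - d) = A + cross d (q - s.1) by rewrite /A /cross !cE; ring.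
rewrite {}EAB in q3 q4; set B := cross d (q - s.1) in q3 q4.
have [B0|B0] := leP 0 B; [left|right].
  by rewrite /tri /= -/d -/l -/D -/A -/B; split=> //; lra.
rewrite /tri /bump /= -/d addlK left60_turn turnZ.
have TE : turn_right60 d = d - l by rewrite /l /left60 opprB addrC subrK.
rewrite TE.
have E1 : cross (q - (s.1 + 3^-1 *: d)) (3^-1 *: d) = - B / 3.
  by rewrite /B /cross !cE; field.
have E2 : cross (3^-1 *: (d - l)) (q - (s.1 + 3^-1 *: d)) = (B + A - D / 3) / 3.
  by rewrite /B /A /D /cross !cE; field.
have E3 : cross (3^-1 *: (d - l)) (3^-1 *: d) = D / 9.
  by rewrite /D /cross !cE; field.
by rewrite E1 E2 E3; split; lra.
Qed.

Definition triU S : set 'cV[R]_2 := [set p | exists2 s, s \in S & tri s p].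

(** The polygon obtained by adding the bumps one generation after the other;
    the triangles on the left of the other new sides add nothing to it. *)
Fixpoint region n : set 'cV[R]_2 :=
  if n is m.+1 then region m `|` triU (KS_sides n) else triU (KS_sides 0).

Lemma triU_closed S : closed (triU S).
Proof.
apply: (@closed_bigcup _ _ [set` S] tri); first exact: finite_seq.
by move=> s _; apply: tri_closed.
Qed.

Lemma region_closed n : closed (region n).
Proof.
elim: n => [|n IH]; first exact: triU_closed.
by apply: closedU => //; apply: triU_closed.
Qed.

Lemma tri_bounded s : 0 < cross (s.2 - s.1) (left60 (s.2 - s.1)) ->
  exists M : R, forall p, tri s p -> `|p| <= M.
Proof.
set d := s.2 - s.1; set l := left60 d; set D := cross d l => D0.
exists (`|s.1| + (`|d| + `|l|)) => p [].
rewrite -/d -/l -/D; set A := cross _ l; set B := cross d _ => a b ab.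
have -> : p = s.1 + (p - s.1) by rewrite addrC subrK.
apply: (le_trans (ler_normD _ _)); rewrite lerD2l.
rewrite -(ler_pM2l D0) -{1}(gtr0_norm D0) -normrZ cross_basis -/A -/B.
apply: (le_trans (ler_normD _ _)); rewrite mulrDr !normrZ (ger0_norm a) (ger0_norm b).
by apply: lerD; apply: ler_wpM2r => //; lra.
Qed.

Lemma triU_bounded S : (forall s, s \in S -> 0 < cross (s.2 - s.1) (left60 (s.2 - s.1))) ->
  exists M : R, forall p, triU S p -> `|p| <= M.
Proof.
elim: S => [|s S IH] H; first by exists 0 => p [].
have [|M1 H1] := IH; first by move=> s' s'S; apply: H; rewrite inE s'S orbT.
have [|M2 H2] := @tri_bounded s; first by apply: H; rewrite inE eqxx.
exists (Num.max M1 M2) => p [s']; rewrite inE le_max => /predU1P[->|s'S] hp.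
  by rewrite H2 ?orbT.
by rewrite H1 //; exists s'.
Qed.

Lemma sides_cross_gt0 n s : s \in KS_sides n -> 0 < cross (s.2 - s.1) (left60 (s.2 - s.1)).
Proof. by move/sides_edge/edge_cross_gt0. Qed.

Lemma region_bounded n : bounded_set (region n).
Proof.
apply/bounded_setP; elim: n => [|n [M IH]].
  exact: triU_bounded (@sides_cross_gt0 0).
have [M' H'] := triU_bounded (@sides_cross_gt0 n.+1).
exists (Num.max M M') => p [/IH|/H'] H; by rewrite le_max H ?orbT.
Qed.

Lemma region_sides n s : s \in KS_sides n -> tri s `<=` region n.
Proof. by move=> sS p hp; case: n sS => [|n] sS; [|right]; exists s. Qed.

(** The outer thirds of s are sides of the next polygon, and the middle third
    becomes interior. *)
Lemma region_step n s p : s \in KS_sides n -> side_set s p ->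
  (\forall q \near p, region n.+1 q) \/ KS n.+1 p.
Proof.
move=> sS [t /andP[t0 t1] pE]; set d := s.2 - s.1 in pE.
have sub s' : s' \in koch_replace s -> s' \in KS_sides n.+1.
  by move=> ?; apply/flatten_mapP; exists s.
have [t3|t3] := leP t (3^-1).
  right; exists (s.1, s.1 + 3^-1 *: d); first by apply: sub; rewrite !inE eqxx.
  exists (t * 3); first by apply/andP; split; lra.
  by rewrite pE /= addlK scalerA; congr (_ + _ *: _); field.
have [t6|t6] := leP (2 / 3) t.
  right; exists (s.1 + 3^-1 *: d + 3^-1 *: d, s.2).
    by apply: sub; rewrite !inE eqxx !orbT.
  exists (t * 3 - 2); first by apply/andP; split; lra.
  rewrite pE /= (_ : s.2 = s.1 + d); last by rewrite /d addrC subrK.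
  by apply: vec_ext; rewrite !cE; field.
left; have := middle_interior (sides_cross_gt0 sS) pE.
rewrite t3 t6 => /(_ isT); apply: filterS => q [|] hq.
  by left; apply: (region_sides sS).
right; exists (bump s) => //; apply: sub; by rewrite !inE eqxx orbT.
Qed.

(** A point of a new triangle is interior to it, on a new side, on the middle
    third of an old side, or in a triangle of the previous generation.  The last
    two cases are settled by the induction hypothesis and [region_step]. *)
Lemma region_frontier n p : region n p ->
  (\forall q \near p, region n q) \/ KS n p.
Proof.
elim: n p => [|n IH] p.
  move=> [s sS hp].
  have [F|F] := tri_frontier (sides_cross_gt0 sS) hp.
    by left; apply: filterS F => q; apply: region_sides.
  have r2 := @rho2 R.
  right; have AB : left60 (vec2 1 0 - vec2 0 0) = vec2 (1 / 2) (Num.sqrt 3 / 2).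
    by rewrite /left60; apply: vec_ext; rewrite /turn_right60 -/rho !cE; lra.
  have BC : left60 (vec2 (1 / 2) (Num.sqrt 3 / 2) - vec2 1 0) = vec2 (-1) 0.
    by rewrite /left60; apply: vec_ext; rewrite /turn_right60 -/rho !cE; lra.
  have CA : left60 (vec2 0 0 - vec2 (1 / 2) (Num.sqrt 3 / 2)) = vec2 (1 / 2) (- (Num.sqrt 3 / 2)).
    by rewrite /left60; apply: vec_ext; rewrite /turn_right60 -/rho !cE; lra.
  have BCp : vec2 1 0 + vec2 (-1) 0 = vec2 0 0 :> 'cV[R]_2.
    by apply: vec_ext; rewrite !cE; ring.
  have CAp : vec2 (1 / 2) (Num.sqrt 3 / 2) + vec2 (1 / 2) (- (Num.sqrt 3 / 2)) = vec2 1 0 :> 'cV[R]_2.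
    by apply: vec_ext; rewrite !cE; field.
  have ABp : vec2 0 0 + vec2 (1 / 2) (Num.sqrt 3 / 2) = vec2 (1 / 2) (Num.sqrt 3 / 2) :> 'cV[R]_2.
    by apply: vec_ext; rewrite !cE add0r.
  have mem q s' : s' \in KS_sides 0 -> side_set s' q -> KS 0 q by exists s'.
  move: sS F => /=; set A := vec2 0 0; set B := vec2 1 0; set C := vec2 (1 / 2) _.
  rewrite !inE => /or3P[] /eqP-> /=; rewrite ?AB ?BC ?CA ?ABp ?BCp ?CAp;
   by case; apply: mem; rewrite !inE eqxx ?orbT.
have main q : region n q -> (\forall q' \near q, region n.+1 q') \/ KS n.+1 q.
  move=> /IH[F|[s sS hs]]; last exact: region_step hs.
  by left; apply: filterS F => q' ?; left.
move=> [/main//|[s' /[dup] s'S /flatten_mapP[s sS s's] hp]].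
have hs' := sides_cross_gt0 s'S; have hs := sides_cross_gt0 sS.
set d := s.2 - s.1 in hs *; set l := left60 d in hs *.
have mem q s2 : s2 \in koch_replace s -> side_set s2 q -> KS n.+1 q.
  by move=> *; exists s2 => //; apply/flatten_mapP; exists s.
move: (s's); rewrite /koch_replace -/d; set t := 3^-1 *: d.
have tl : left60 t = 3^-1 *: l by rewrite left60Z.
have s2E : s.2 = s.1 + d by rewrite /d addrC subrK.
have mid q : side_set (s.1 + t + t, s.1 + t) q -> side_set s q.
  move=> [a /andP[a0 a1] ->]; exists ((2 - a) / 3); first by apply/andP; split; lra.
  by rewrite -/d; apply: vec_ext; rewrite /t /= !cE; field.
rewrite !inE => /or4P[] /eqP E.
- apply: main; apply: (region_sides sS).
  move: hp; rewrite E /tri /= -/d -/l addlK tl.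
  have -> : cross (p - s.1) (3^-1 *: l) = cross (p - s.1) l / 3 by rewrite crossZr mulrC.
  have -> : cross t (p - s.1) = cross d (p - s.1) / 3 by rewrite crossZl mulrC.
  have -> : cross t (3^-1 *: l) = cross d l / 9 by rewrite crossZr crossZl; field.
  by move=> [a b ab]; split; lra.
- have [F|F] := tri_frontier hs' hp.
    by left; apply: filterS F => q; apply: region_sides.
  move: F; rewrite E /= addlK left60_turn => -[] F.
  + by right; apply: mem F; rewrite /koch_replace -/d -/t !inE eqxx orbT.
  + by right; apply: mem F; rewrite /koch_replace -/d -/t !inE eqxx !orbT.
  + exact: region_step (mid _ F).
- have [F|F] := tri_frontier hs' hp.
    by left; apply: filterS F => q; apply: region_sides.
  have dE : s.1 + t + t - (s.1 + t + turn_right60 t) = left60 t.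
    by rewrite /left60 opprD addrACA subrr add0r.
  have lE : left60 (left60 t) = - turn_right60 t.
    exact: left60_left60.
  have pE : s.1 + t + turn_right60 t + - turn_right60 t = s.1 + t by rewrite addrK.
  move: F; rewrite E /= dE lE pE => -[] F.
  + by right; apply: mem F; rewrite /koch_replace -/d -/t !inE eqxx !orbT.
  + exact: region_step (mid _ F).
  + by right; apply: mem F; rewrite /koch_replace -/d -/t !inE eqxx !orbT.
- apply: main; apply: (region_sides sS).
  move: hp; rewrite E /tri /= -/d -/l.
  have -> : s.2 - (s.1 + t + t) = t.
    by rewrite s2E; apply: vec_ext; rewrite /t !cE; field.
  rewrite tl.
  have -> : cross (p - (s.1 + t + t)) (3^-1 *: l) = (cross (p - s.1) l - 2 / 3 * cross d l) / 3.
    by rewrite /t /cross !cE; field.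
  have -> : cross t (p - (s.1 + t + t)) = cross d (p - s.1) / 3.
    by rewrite /t /cross !cE; field.
  have -> : cross t (3^-1 *: l) = cross d l / 9 by rewrite crossZr crossZl; field.
  by move: hs => + [a b ab]; rewrite -/l => hs; split; lra.
Qed.

(** A component of the complement of KS_n does not meet the frontier of the
    region, by [region_frontier]; being connected, it is contained in the
    region as soon as it meets it, and then it is bounded. *)
Lemma region_Omega n p : region n p -> Omega n p.
Proof.
move=> hp; case: (pselect (KS n p)) => K; [by left|right].
apply/bounded_setP; have /bounded_setP[M HM] := region_bounded n.
exists M => x Cx; apply: HM; move: x Cx.
set C := connected_component _ _.
have CK x : C x -> ~ KS n x by apply: connected_component_sub.
have Cp : C p by apply: connected_component_refl.
suff -> : C = C `&` region n by move=> x [].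
symmetry; apply: component_connected; first by exists p.
  exists (region n)°; first exact: open_interior.
  apply/seteqP; split=> x [Cx rx]; split=> //; last exact: interior_subset.
  by case: (region_frontier rx) => // /(CK _ Cx).
by exists (region n) => //; apply: region_closed.
Qed.

(** The barycentre of the lattice triangle on the left of a side is in the
    region, and lies on no lattice line: its coordinates in a basis of units are
    thirds of integers which are not divisible by 3. *)
Lemma Omega_interior n : exists q, (@Omega R n `\` KS n) q.
Proof.
have [s sS] : exists s, s \in @KS_sides R n.
  elim: n => [|n [s sS]]; first by exists (vec2 0 0, vec2 1 0); apply: mem_head.
  by eexists; apply/flatten_mapP; exists s => //; apply: mem_head.
have es := sides_edge sS; have [h hh E] := edge_dir es; have [L _] := es.
set d := s.2 - s.1 in E; pose q := s.1 + 3^-1 *: (d + left60 d).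
exists q; split.
  apply: region_Omega; apply: (region_sides sS); rewrite /tri /= -/d.
  have := sides_cross_gt0 sS; rewrite -/d; set l := left60 d => D0.
  have -> : cross (q - s.1) l = cross d l / 3.
    by rewrite addlK crossZl crossDl crossvv addr0 mulrC.
  have -> : cross d (q - s.1) = cross d l / 3.
    by rewrite addlK crossZr crossDr crossvv add0r mulrC.
  by split; lra.
move=> [s' s'S s'q]; have es' := sides_edge s'S.
have [_ [h' h'h E']] := es'.
have [m Em] := edge_cross es' s'q h'h E'.
have [m2 Em2] : exists k : int, 3 ^+ n * cross (lvp h') s.1 = rho * k%:~R.
  case: L => c [e L]; exists (h'.1 * e - h'.2 * c).
  by rewrite -cross_lv -L crossZr.
have lE : 3 ^+ n *: (d + left60 d) = lvp (h.1 - h.2, h.2 + (h.1 + h.2)).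
  have dE : 3 ^+ n *: d = lvp h by rewrite E scalerA mulfV ?scale1r // pow3_neq0.
  rewrite scalerDr -left60Z dE /left60 turn_right60_lv lvN !lvD /lvp /=.
  by congr (lv _ _); ring.
(* the area of a unit with the sum of two units at an angle of pi/3 is rho
   times an integer prime to 3 *)
have : (rho : R) * (3 * (m - m2))%:~R = rho * (h'.1 * (h.2 + (h.1 + h.2)) - h'.2 * (h.1 - h.2))%:~R.
  rewrite -(cross_lv h'.1 h'.2 (h.1 - h.2) (h.2 + (h.1 + h.2))).
  rewrite -/(lvp (h.1 - h.2, h.2 + (h.1 + h.2))) -lE crossZr.
  have -> : cross (lv h'.1 h'.2) (d + left60 d) = 3 * (cross (lvp h') q - cross (lvp h') s.1).
    by rewrite /q [cross _ (s.1 + _)]crossDr crossZr /lvp; field.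
  by rewrite intrM rmorphB /= mulrCA (mulrBr rho) -Em -Em2; ring.
move=> /(mulfI (lt0r_neq0 rho_gt0)) /intr_inj.
move: (m - m2) => k; move: hh h'h; rewrite !inE.
by do 6?[case/orP]; move/eqP->; do 6?[case/orP]; move/eqP->; rewrite /=; lia.
Qed.

End Region.

(** * Partial bijections of finite sets *)

Section FiniteDynamics.

Lemma least_nat (P : nat -> Prop) : (exists k, P k) ->
  exists m, P m /\ forall k, (k < m)%N -> ~ P k.
Proof.
move=> [k0 Pk0]; have ex : exists k, `[< P k >] by exists k0; apply/asboolP.
case: (ex_minnP ex) => m /asboolP Pm Hm; exists m; split=> // k km /asboolP /Hm.
by rewrite leqNgt km.
Qed.

Lemma pigeonhole (T : Type) (A : set T) (f : nat -> T) : finite_set A ->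
  (forall k, A (f k)) -> exists i j, (i < j)%N /\ f i = f j.
Proof.
move=> finA fA; apply: contrapT => H.
have fI : {in f @^-1` A &, injective f}.
  move=> i j _ _ E; case: (ltngtP i j) => // ij.
    by case: H; exists i, j.
  by case: H; exists j, i.
apply: infinite_nat; apply: sub_finite_set (finite_preimage fI finA) => k _.
exact: fA.
Qed.

(** Follow the orbit of z forwards.  If it never stops, it meets the same point
    twice, and by injectivity it is a cycle through z.  If it stops, follow it
    backwards: if this never stopped, z would be on a cycle for the same
    reason, contradiction. *)
Lemma partial_bijection_orbits (T : Type) (A : set T) (E : T -> T -> Prop) z :
  finite_set A -> (forall a b, E a b -> A a <-> A b) ->
  (forall a b b', E a b -> E a b' -> b = b') ->
  (forall a a' b, E a b -> E a' b -> a = a') -> A z ->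
  (exists o N, [/\ (0 < N)%N, o 0%N = z, forall k, E (o k) (o k.+1) &
                   forall k, o (k + N)%N = o k]) \/
  (exists m j o, [/\ (j <= m)%N /\ o j = z, forall k, (k < m)%N -> E (o k) (o k.+1),
                     forall a, ~ E a (o 0%N) & forall b, ~ E (o m) b]).
Proof.
move=> finA EA Efun Einj Az.
have /choice[nxt nxtP] : forall a, exists b, (exists b', E a b') -> E a b.
  by move=> a; case: (pselect (exists b', E a b')) => [[b Eb]|N]; [exists b|exists a].
have /choice[prv prvP] : forall b, exists a, (exists a', E a' b) -> E a b.
  by move=> a; case: (pselect (exists b', E b' a)) => [[b Eb]|N]; [exists b|exists a].
pose f k := iter k nxt z; pose g k := iter k prv z.
have [Hf|] := pselect (forall k, exists b, E (f k) b).
  left; have fE k : E (f k) (f k.+1) by apply: nxtP.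
  have fA k : A (f k) by elim: k => // k IH; rewrite -(EA _ _ (fE k)).
  have [i [j [ij fij]]] := pigeonhole finA fA.
  exists f, (j - i)%N; split=> //; first by rewrite subn_gt0.
  have f0 : f (j - i)%N = z.
    elim: i j ij fij => [|i IH] j ij fij; first by rewrite subn0 -fij.
    case: j ij fij => // j ij fij; rewrite subSS; apply: IH => //.
    by apply: Einj (fE _) _; rewrite fij.
  by move=> k; rewrite /f iterD [iter (j - i) _ _]f0.
move=> /existsNP /least_nat[m [dead live]].
have fE k : (k < m)%N -> E (f k) (f k.+1) by move=> /live/contrapT; apply: nxtP.
have [Hg|] := pselect (forall k, exists a, E a (g k)).
  exfalso; have gE k : E (g k.+1) (g k) by apply: prvP.
  have gA k : A (g k) by elim: k => // k IH; rewrite (EA _ _ (gE k)).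
  have [i [j [ij gij]]] := pigeonhole finA gA.
  (* by determinism the coincidence of two indices moves back to index 0 *)
  have [N g0] : exists N, g N.+1 = z.
    exists (j - i).-1; rewrite prednK ?subn_gt0 //.
    elim: i j ij gij => [|i IH] j ij gij; first by rewrite subn0 -gij.
    case: j ij gij => // j ij gij; rewrite subSS; apply: IH => //.
    by apply: Efun (gE _) _; rewrite gij.
  (* z is on a cycle, which the forward orbit cannot leave *)
  have fg k : exists i', f k = g i'.+1.
    elim: k => [|k [i' IH]]; first by exists N.
    have Ek : E (f k) (g i') by rewrite IH.
    have {}Ek : f k.+1 = g i' by apply: (Efun (f k)) => //; apply: nxtP; exists (g i').
    by rewrite Ek; case: i' {IH Ek} => [|i']; [exists N; rewrite g0|exists i'].
  by have [i' Ei] := fg m; apply: dead; exists (g i'); rewrite Ei.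
move=> /existsNP /least_nat[j [source live']]; right.
have gE k : (k < j)%N -> E (g k.+1) (g k) by move=> /live'/contrapT; apply: prvP.
exists (j + m)%N, j, (fun k => if (k <= j)%N then g (j - k)%N else f (k - j)%N); split.
- by rewrite leq_addr leqnn subnn.
- move=> k km; have [kj|jk] := ltnP k j.
    rewrite (ltnW kj) -(subnSK kj); apply: gE.
    by rewrite ltn_subrL /= (leq_ltn_trans _ kj).
  rewrite subSn //; have -> : (if (k <= j)%N then g (j - k)%N else f (k - j)%N) = f (k - j)%N.
    by case: ifP => // kj; rewrite (_ : k = j) ?subnn //; apply/eqP; rewrite eqn_leq kj.
  by apply: fE; rewrite ltn_subLR.
- by move=> a Ea; apply: source; exists a; rewrite subn0 in Ea.
- move=> b; rewrite addKn; case: ifP => [jm|_] Eb; apply: dead; exists b => //.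
  have m0 : m = 0%N by apply/eqP; rewrite -leqn0 -(leq_add2l j) addn0.
  by rewrite m0; move: Eb; rewrite m0 addn0 subnn.
Qed.

End FiniteDynamics.

(** * States, bounces and rational directions *)

Section Bounces.
Context {R : realType}.
Implicit Types (n : nat) (p q u v w x y : 'cV[R]_2) (g r : 'M[R]_2).
Implicit Types (s : 'cV[R]_2 * 'cV[R]_2) (z : 'cV[R]_2 * 'M[R]_2).

(** Unlike in [first_hit_ex], the starting point may be on KS_n, where only the
    germ of the ray is known to be inside. *)
Lemma hit_ex n x u : u != 0 -> inward n x u ->
  exists t : R, [/\ 0 < t, KS n (x + t *: u) &
    forall t', 0 < t' < t -> (Omega n `\` KS n) (x + t' *: u)].
Proof.
move=> u0 /near0P[e e0 He].
have e2 : 0 < e / 2 by rewrite divr_gt0.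
have hp := He (e / 2); rewrite e2 /= in hp.
have [|t [t0 Kt Ht]] := first_hit_ex u0 (hp _); first by lra.
exists (e / 2 + t); split; [by rewrite addr_gt0|by rewrite scalerDl addrA|].
move=> t' /andP[t'0 t't]; have [le|lt] := leP (e / 2) t'.
  have -> : x + t' *: u = x + (e / 2) *: u + (t' - e / 2) *: u.
    by rewrite -addrA -scalerDl [e / 2 + _]addrC subrK.
  by apply: Ht; apply/andP; split; lra.
by apply: He; apply/andP; split; lra.
Qed.

Lemma first_hitE n x u (t : R) y : 0 < t -> KS n (x + t *: u) ->
  (forall t', 0 < t' < t -> ~ KS n (x + t' *: u)) -> first_hit n x u y -> y = x + t *: u.
Proof.
move=> t0 Kt Ht [t1 [t10 -> K1 H1]]; case: (ltgtP t t1) => [tt|tt|->//].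
  by case: (H1 t) => //; rewrite t0.
by case: (Ht t1) => //; rewrite t10.
Qed.

Lemma first_hit_Omega n x u y : u != 0 -> inward n x u -> first_hit n x u y ->
  exists t : R, [/\ 0 < t, y = x + t *: u, KS n y &
    forall t', 0 < t' < t -> (Omega n `\` KS n) (x + t' *: u)].
Proof.
move=> u0 Iu hy; have [t [t0 Kt Ht]] := hit_ex u0 Iu.
have yE : y = x + t *: u.
  by apply: first_hitE hy => // t' /Ht[].
by exists t; rewrite yE.
Qed.

(** The reversed ray runs back along the same free segment. *)
Lemma first_hit_back n x u y : u != 0 -> inward n x u -> first_hit n x u y ->
  inward n y (- u).
Proof.
move=> u0 Iu hy; have [t [t0 -> Kt Ht]] := first_hit_Omega u0 Iu hy.
apply/near0P; exists t => // t' /andP[t'0 t't].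
rewrite scalerN -addrA -scalerBl; apply: Ht; apply/andP; split; lra.
Qed.

Lemma first_hit_fun n x u y y' : first_hit n x u y -> first_hit n x u y' -> y = y'.
Proof. by move=> [t [t0 -> Kt Ht]] /(first_hitE t0 Kt Ht). Qed.

Lemma first_hit_inj n x x' u y : KS n x -> KS n x' ->
  first_hit n x u y -> first_hit n x' u y -> x = x'.
Proof.
move=> Kx Kx' [t [t0 E _ H]] [t' [t'0 E' _ H']].
have xE : x = x' + (t' - t) *: u.
  by rewrite scalerBl addrA -E' E addrK.
have x'E : x' = x + (t - t') *: u.
  by rewrite scalerBl addrA -E E' addrK.
case: (ltgtP t t') => tt.
- by case: (H' (t' - t)); rewrite -?xE // subr_gt0 tt ltrBlDr ltrDl.
- by case: (H (t - t')); rewrite -?x'E // subr_gt0 tt ltrBlDr ltrDl.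
- by rewrite xE tt subrr scale0r addr0.
Qed.

Lemma side_refl_uniq n s s' y : s \in KS_sides n -> s' \in KS_sides n ->
  side_set s y -> side_set s' y -> ~ KS_vertex n y -> side_refl s' = side_refl s.
Proof.
move=> sS s'S sy s'y nv.
have [c c0 E] := edge_meet (sides_edge sS) (sides_edge s'S) sy s'y (nonvertex_lat sS sy nv).
exact: side_refl_par c0 E.
Qed.

Section Direction.
Variables (n : nat) (v : 'cV[R]_2).
Hypothesis v0 : v != 0.

(** The direction in the plane of the polygon of a trajectory which has the
    direction v on the surface, in the sheet z.2. *)
Definition heading z : 'cV[R]_2 := invmx z.2 *m v.

Definition state z : Prop := [/\ KS n z.1, D3 n z.2 & inward n z.1 (heading z)].

Definition bounce z z' : Prop := [/\ state z, first_hit n z.1 (heading z) z'.1,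
  ~ KS_vertex n z'.1 & exists s, [/\ s \in KS_sides n, side_set s z'.1 &
    z'.2 = z.2 *m side_refl s]].

Lemma D3_unit g : D3 n g -> g \in unitmx.
Proof. by case/D3_hexsym. Qed.

Lemma D3_refl s : s \in KS_sides n -> D3 n (side_refl s).
Proof. by move=> sS; apply: generated_in; exists s. Qed.

Lemma D3M g r : D3 n g -> D3 n r -> D3 n (g *m r).
Proof. exact: generated_mul. Qed.

Lemma refl_inv s : s \in KS_sides n -> invmx (side_refl s) = side_refl s.
Proof. by move=> sS; exact: side_refl_inv (edge_neq (sides_edge sS)). Qed.

Lemma refl_invol s : s \in KS_sides n -> side_refl s *m side_refl s = 1%:M.
Proof. by move=> sS; exact: side_refl_invol (edge_neq (sides_edge sS)). Qed.

Lemma heading_refl x x' g s : D3 n g -> s \in KS_sides n ->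
  heading (x', g *m side_refl s) = side_refl s *m heading (x, g).
Proof.
move=> Dg sS; rewrite /heading /= invmxM ?refl_inv ?mulmxA ?D3_unit //.
exact: D3_refl.
Qed.

Lemma heading_neq0 z : D3 n z.2 -> heading z != 0.
Proof.
move=> /D3_unit U; apply: contra v0 => /eqP E.
by rewrite -[X in X == _](mulKVmx U) -/(heading z) E mulmx0.
Qed.

Lemma state_hit z : state z -> exists y, first_hit n z.1 (heading z) y.
Proof.
move=> [Kz Dz Iz]; have [t [t0 Kt Ht]] := hit_ex (heading_neq0 Dz) Iz.
exists (z.1 + t *: heading z), t; split=> // t' /Ht[]//.
Qed.

Lemma bounce_state z z' : bounce z z' -> state z'.
Proof.
move=> [[Kz Dz Iz] hz nv [s [sS sz' E]]].
have := first_hit_back (heading_neq0 Dz) Iz hz => Ib.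
have := inward_mirror sS sz' nv Ib.
rewrite mulmxN opprK => Im; split.
- by exists s.
- by rewrite E; apply: D3M => //; apply: D3_refl.
- have -> // : heading z' = side_refl s *m heading z.
  by case: z' E {hz nv sz' Ib Im} => x' g' /= ->; case: z Dz {Kz Iz} => x g Dz; apply: heading_refl.
Qed.

Lemma bounce_state1 z z' : bounce z z' -> state z. Proof. by case. Qed.

Lemma bounce_ex z y : state z -> first_hit n z.1 (heading z) y -> ~ KS_vertex n y ->
  exists z', bounce z z'.
Proof.
move=> Sz hy nv; have [t [_ _ [s sS sy] _]] := hy.
by exists (y, z.2 *m side_refl s); split=> //; exists s.
Qed.

Lemma bounce_fun z z1 z2 : bounce z z1 -> bounce z z2 -> z1 = z2.
Proof.
case: z1 z2 => [x1 g1] [x2 g2] [_ /= h1 nv1 [s1 [/= s1S s1x ->]]] [_ /= h2 _ [s2 [/= s2S s2x ->]]].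
have E := first_hit_fun h1 h2; rewrite -E in s2x *.
by rewrite (side_refl_uniq s1S s2S s1x s2x nv1).
Qed.

(** The last reflection is determined by the point z.1, hence so is the incoming
    direction; the starting point is the last point of KS_n before z.1 on
    this line. *)
Lemma bounce_inj z1 z2 z : bounce z1 z -> bounce z2 z -> z1 = z2.
Proof.
case: z1 z2 => [x1 g1] [x2 g2] [[/= K1 _ _] h1 nv [s1 [/= s1S s1x E1]]].
move=> [[/= K2 _ _] h2 _ [s2 [/= s2S s2x E2]]].
have E : g1 = g2.
  have : g1 *m side_refl s1 *m side_refl s1 = g2 *m side_refl s1 *m side_refl s1.
    by rewrite -E1 E2 (side_refl_uniq s1S s2S s1x s2x nv).
  by rewrite -!mulmxA refl_invol // !mulmx1.
rewrite -E in h2 *; congr (_, _).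
exact: first_hit_inj K1 K2 h1 h2.
Qed.

(** Reverse time: shoot from x along the mirror image of the reversed heading. *)
Lemma bounce_pred z : state z -> ~ KS_vertex n z.1 -> exists z', bounce z' z.
Proof.
case: z => x g Sz nv; have [[s sS sx] Dg Ix] := Sz; rewrite /= in sx Dg Ix nv.
set u := heading _ in Ix.
have Dgs : D3 n (g *m side_refl s) by apply: D3M => //; apply: D3_refl.
have uE x' : heading (x', g *m side_refl s) = side_refl s *m u by apply: heading_refl.
have Im := inward_mirror sS sx nv Ix.
have n0 : - (side_refl s *m u) != 0.
  by rewrite oppr_eq0 -(uE x); apply: heading_neq0.
have [t [t0 Kt Ht]] := hit_ex n0 Im.
set y := x + _ in Kt.
have yx : x = y + t *: (side_refl s *m u) by rewrite /y scalerN subrK.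
have H t' : 0 < t' < t -> (Omega n `\` KS n) (y + t' *: (side_refl s *m u)).
  move=> /andP[a b]; have := Ht (t - t'); rewrite /y scalerBl !scalerN opprK addrA.
  by apply; apply/andP; split; lra.
have Kx : KS n x by exists s.
exists (y, g *m side_refl s); split=> //=.
- by split=> //=; rewrite uE; apply/near0P; exists t.
- by rewrite uE; exists t; split=> // t' /H[].
- by exists s; split=> //; rewrite -mulmxA refl_invol // mulmx1.
Qed.

End Direction.

(** The lattices of all meshes 3^-n define the same rational directions, by
    [lat_rational]. *)
Definition rational v : Prop := exists2 c : R, c != 0 & lat 0 (c *: v).

(** The developing map, well defined on the surface modulo the lattice. *)
Definition unfold z : 'cV[R]_2 := z.2 *m z.1.

(** By [refl_on_side] the difference is the image under g of a lattice vector. *)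
Lemma unfold_refl n g s y : D3 n g -> s \in KS_sides n -> side_set s y ->
  lat n (unfold (y, g *m side_refl s) - unfold (y, g)).
Proof.
move=> Dg sS sy; have es := sides_edge sS; rewrite /unfold /= -mulmxA -mulmxBr.
have [_ Hg _] := D3_hexsym Dg; apply: hexmap_lat => //.
rewrite (refl_on_side (edge_neq es) sy).
have [_ Hs _] := hexsym_refl es; have [L _] := es.
by apply: latB => //; apply: hexmap_lat.
Qed.

Lemma heading_unfold v z (t : R) : z.2 \in unitmx ->
  z.2 *m (z.1 + t *: heading v z) = unfold z + t *: v.
Proof.
by move=> U; rewrite mulmxDr -scalemxAr /heading mulKVmx.
Qed.

(** During a flight the unfolded point moves along v, and at the bounce
    [unfold_refl] changes it by a lattice vector. *)
Lemma bounce_unfold n v z z' : bounce n v z z' ->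
  exists t : R, 0 < t /\ lat n (unfold z' - unfold z - t *: v).
Proof.
move=> [[_ Dz _] [t [t0 zE _ _]] _ [s [sS sz' E]]]; exists t; split=> //.
have L := unfold_refl Dz sS sz'; rewrite -E in L.
move: L; rewrite /unfold /= -!/(unfold _) [in X in lat n (_ - X)]zE.
by rewrite heading_unfold ?(D3_unit Dz) // opprD addrA.
Qed.

Lemma finite_int (N : nat) : finite_set [set m : int | `|m| <= N%:Z].
Proof.
apply: (@sub_finite_set _ _ [set (k%:Z - N%:Z) | k in `I_(N + N).+1]).
  move=> m /=; rewrite ler_norml => /andP[a b].
  exists (absz (m + N%:Z)); last by lia.
  by rewrite /=; lia.
by apply: finite_image; apply: finite_II.
Qed.

Lemma finite_arith (a b k : R) : a != 0 -> 0 < k ->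
  finite_set [set t : R | 0 <= t <= 1 /\ exists m : int, a * t + b = m%:~R * k].
Proof.
move=> a0 k0.
have [N HN] : exists N : nat, (`|a| + `|b|) / k <= N%:R.
  by exists (Num.bound ((`|a| + `|b|) / k)); apply/ltW/archi_boundP; rewrite divr_ge0 ?addr_ge0 // ltW.
apply: (@sub_finite_set _ _ [set (m%:~R * k - b) / a | m in [set m : int | `|m| <= N%:Z]]).
  move=> t [/andP[t0 t1] [m E]]; exists m; last by rewrite /= -E addrK mulrC mulKf.
  rewrite /= -(ler_int R) intr_norm; apply: le_trans HN.
  rewrite ler_pdivlMr // -{1}(gtr0_norm k0) -normrM -E; apply: (le_trans (ler_normD _ _)).
  by rewrite lerD2r normrM ler_piMr // ger0_norm.
by apply: finite_image; apply: finite_int.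
Qed.

(** The states whose unfolded point is on one of the equidistant lines of
    direction l where the area is a modulo k. *)
Definition level_set n v (l : 'cV[R]_2) (a k : R) : set ('cV[R]_2 * 'M[R]_2) :=
  [set z | state n v z /\ exists m : int, cross (unfold z) l = a + m%:~R * k].

(** An inward heading is transverse to the side it starts from.  So the area
    is on each side a non constant affine function of the position, and takes
    each value in a + k Z at most once; bounded positions leave finitely many
    such values. *)
Lemma level_set_finite n v l (a k : R) : v != 0 -> (exists2 c : R, c != 0 & l = c *: v) ->
  0 < k -> finite_set (level_set n v l a k).
Proof.
move=> v0 [c c0 lE] k0.
pose P g := \bigcup_(s in [set s | s \in KS_sides n /\ cross (g *m (s.2 - s.1)) l != 0])
   [set s.1 + t *: (s.2 - s.1) | t in
  [set t : R | 0 <= t <= 1 /\ exists m : int,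
     cross (g *m (s.2 - s.1)) l * t + (cross (g *m s.1) l - a) = m%:~R * k]].
(* the vertices, and the points where a side crosses one of the lines *)
pose Q := [set s.1 | s in [set` KS_sides n]] `|` \bigcup_(g in [set g | hexsym g]) P g.
have : finite_set (Q `*` [set g : 'M[R]_2 | hexsym g]).
  apply: finite_setX; last exact: hexsym_finite.
  rewrite finite_setU; split; first by apply/finite_image/finite_seq.
  apply: bigcup_finite; first exact: hexsym_finite.
  move=> g _; apply: bigcup_finite.
    by apply: sub_finite_set (finite_seq (KS_sides n)) => s [].
  by move=> s [_ d0]; apply: finite_image; apply: finite_arith.
apply: sub_finite_set => -[x g] [Sz [m E]]; rewrite /unfold /= in E.
have [[s sS sx] Dg Ix] := Sz; have Hg := D3_hexsym Dg; rewrite /= in sx Dg Ix.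
split=> //=; case: (pselect (KS_vertex n x)) => [[s' s'S ->]|nv].
  by left; exists s'.
right; exists g => //; exists s.
  split=> //; apply: contra (inward_transverse sS sx nv Ix) => /eqP d0.
  have [gU _ _] := Hg.
  have v0' : l != 0 by rewrite lE scaler_eq0 negb_or c0.
  have [b bE] : exists b, g *m (s.2 - s.1) = b *: l.
    by apply: cross0_par => //; apply: oppr_inj; rewrite oppr0 -[RHS]d0 /cross; ring.
  have -> : s.2 - s.1 = (b * c) *: heading v (x, g).
    by rewrite -scalerA scalemxAr /heading /= -lE -[LHS](mulKmx gU) bE -scalemxAr.
  by rewrite crossZl crossvv mulr0.
case: sx => t t01 xE; exists t => //; split=> //; exists m.
move: E; rewrite xE mulmxDr -scalemxAr crossDl crossZl => E.
by rewrite [_ * t]mulrC addrA [_ + cross (g *m s.1) l]addrC E addrC addKr.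
Qed.

(** The level set of z is finite and stable under bounces in both time
    directions.  Its states without successor run into a vertex, and those
    without predecessor start from a vertex. *)
Lemma orbit_dichotomy n v z : v != 0 -> rational v -> state n v z ->
  (exists o N, [/\ (0 < N)%N, o 0%N = z, (forall k, bounce n v (o k) (o k.+1)),
     (forall k, o (k + N)%N = o k) & finite_set (range o)]) \/
  (exists m j o, [/\ (j <= m)%N /\ o j = z, KS_vertex n (o 0%N).1,
     forall k, (k < m)%N -> bounce n v (o k) (o k.+1) &
     state n v (o 0%N) /\
     exists2 y, first_hit n (o m).1 (heading v (o m)) y & KS_vertex n y]).
Proof.
move=> v0 [c c0 Lv] Sz; set l := c *: v in Lv.
pose k := @rho R / (3 ^+ n * 3 ^+ n).
have k0 : 0 < k by rewrite divr_gt0 ?rho_gt0 // mulr_gt0 // pow3_gt0.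
pose A := level_set n v l (cross (unfold z) l) k.
have finA : finite_set A by apply: level_set_finite => //; exists c.
have vl : cross v l = 0 by rewrite crossZr crossvv mulr0.
have AE a b : bounce n v a b -> A a <-> A b.
  move=> Eab; have [t [_ L]] := bounce_unfold Eab.
  have [m mE] := lat_cross L (lat_ge n Lv).
  have {}mE : cross (unfold b) l = cross (unfold a) l + m%:~R * k.
    rewrite -mE !crossDl !crossNl crossZl vl; ring.
  have Sa := bounce_state1 Eab; have Sb := bounce_state v0 Eab.
  split=> -[_ [m' m'E]]; split=> //.
    by exists (m' + m); rewrite mE m'E rmorphD /= mulrDl addrA.
  exists (m' - m); rewrite rmorphB /= mulrBl addrA -m'E mE; ring.
have Az : A z by split=> //; exists 0; rewrite mul0r addr0.
have AS a : A a -> state n v a by case.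
have [[orb [N [N0 oz oE oN]]]|[m [j [orb [[jm oj] oE src snk]]]]] :=
  partial_bijection_orbits finA AE (@bounce_fun n v) (@bounce_inj n v) Az.
  left; exists orb, N; split=> //; apply: sub_finite_set finA => _ [i _ <-].
  by elim: i => [|i IH]; [rewrite oz|rewrite -(AE _ _ (oE i))].
have oA i : (i <= m)%N -> A (orb i).
  have A0 : A (orb 0%N).
    move: Az; rewrite -oj; elim: j {oj} jm => // i' IH im.
    by rewrite -(AE _ _ (oE i' im)); apply: IH; apply: ltnW.
  by elim: i => // i IH im; rewrite -(AE _ _ (oE i im)); apply: IH; apply: ltnW.
right; exists m, j, orb; split=> //.
  apply: contrapT => nv; have [z' /src//] := bounce_pred v0 (AS _ (oA _ (leq0n _))) nv.
split; first exact/AS/oA.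
have Sm := AS _ (oA _ (leqnn m)); have [y hy] := state_hit v0 Sm.
exists y => //; apply: contrapT => nv; have [z' /snk//] := bounce_ex Sm hy nv.
Qed.

End Bounces.

(** * Gluing trajectories on the surface *)

Section Trajectories.
Context {R : realType}.
Implicit Types (p q u w x y : 'cV[R]_2) (g r : 'M[R]_2) (c : R -> 'cV[R]_2 * 'M[R]_2).
Implicit Types (s : 'cV[R]_2 * 'cV[R]_2) (z : 'cV[R]_2 * 'M[R]_2).
Variables (n : nat) (v : 'cV[R]_2).

Definition glide_right c (t : R) : Prop :=
  \forall s \near 0^'+, c (t + s) = ((c t).1 + s *: heading v (c t), (c t).2).

(** On the left of t the trajectory may arrive in another sheet g than that of
    its value at t, as it does at a bounce. *)
Definition glide_left c (t : R) : Prop :=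
  exists g, [/\ D3 n g, surface_eq n (c t) ((c t).1, g) &
    \forall s \near 0^'+, c (t - s) = ((c t).1 - s *: (invmx g *m v), g)].

Lemma surface_eq_refl z : surface_eq n z z.
Proof. by split=> //; constructor 1. Qed.

Lemma glide_geodesic (J : set R) c :
  (forall t, J t -> surface_pt n (c t)) ->
  (forall t t', J t -> J t' -> t < t' -> glide_right c t) ->
  (forall t t', J t -> J t' -> t' < t -> glide_left c t) ->
  geodesic n v J c.
Proof.
move=> Js Jr Jl t Jt; split; first exact: Js.
have [_ Dt] := Js _ Jt; have Ut := D3_unit Dt.
have [e1 e10 H1] : exists2 e, 0 < e & forall t', J t' -> t < t' < t + e ->
    flat_disp n (c t) ((t' - t) *: v) (c t').
  case: (pselect (exists2 t', J t' & t < t')) => [[t' Jt' tt']|N]; last first.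
    by exists 1 => // t' Jt' /andP[tt' _]; case: N; exists t'.
  have /near0P[e e0 He] := Jr _ _ Jt Jt' tt'; exists e => // s Js' /andP[ts se].
  have := He (s - t); rewrite (addrC t) subrK => ->; last by apply/andP; split; lra.
  exists (c t).2; split=> //=.
  - by rewrite -surjective_pairing; apply: surface_eq_refl.
  - exact: surface_eq_refl.
  - by rewrite addlK -scalemxAr /heading mulKVmx.
have [e2 e20 H2] : exists2 e, 0 < e & forall t', J t' -> t - e < t' < t ->
    flat_disp n (c t) ((t' - t) *: v) (c t').
  case: (pselect (exists2 t', J t' & t' < t)) => [[t' Jt' tt']|N]; last first.
    by exists 1 => // t' Jt' /andP[_ tt']; case: N; exists t'.
  have [g [Dg Sg /near0P[e e0 He]]] := Jl _ _ Jt Jt' tt'; exists e => // s Js' /andP[ts se].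
  have := He (t - s); rewrite subKr => ->; last by apply/andP; split; lra.
  exists g; split=> //=.
  - exact: surface_eq_refl.
  - by rewrite addlK mulmxN -scalemxAr mulKVmx ?(D3_unit Dg) // -scaleNr opprB.
exists (Num.min e1 e2); first by rewrite lt_min e10.
move=> s Js'; rewrite lt_min => /andP[se1 se2]; case: (ltgtP s t) => st.
- by apply: H2 => //; move: se2; rewrite ltr_norml => /andP[a b]; apply/andP; split; lra.
- by apply: H1 => //; move: se1; rewrite ltr_norml => /andP[a b]; apply/andP; split; lra.
- rewrite st subrr scale0r; exists (c t).2; split=> //.
  + by rewrite -surjective_pairing; apply: surface_eq_refl.
  + by rewrite -surjective_pairing; apply: surface_eq_refl.
  + by rewrite subrr mulmx0.
Qed.

Definition traj (T : R) c : Prop :=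
  [/\ forall t, 0 <= t < T -> glide_right c t,
      forall t, 0 < t <= T -> glide_left c t,
      forall t, 0 <= t <= T -> surface_pt n (c t) &
      forall t, 0 < t < T -> ~ KS_vertex n (c t).1].

(** The trajectory starts in the sheet of z, and its value at the final time is
    the given representative z'; so trajectories can be concatenated even when
    they change sheet at the common point. *)
Definition reach z z' : Prop := exists T c, [/\ 0 < T, c 0 = z, c T = z' & traj T c].

Definition concat (T : R) c c' : R -> 'cV[R]_2 * 'M[R]_2 :=
  fun t => if t < T then c t else c' (t - T).

Lemma glide_right_eq c c' (t t' : R) : c t = c' t' ->
  (\forall s \near 0^'+, c (t + s) = c' (t' + s)) -> glide_right c' t' -> glide_right c t.
Proof. by move=> E; apply: filterS2 => s -> ->; rewrite E. Qed.

Lemma glide_left_eq c c' (t t' : R) : c t = c' t' ->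
  (\forall s \near 0^'+, c (t - s) = c' (t' - s)) -> glide_left c' t' -> glide_left c t.
Proof.
move=> E H [g [Dg Sg Hg]]; exists g; rewrite E; split=> //.
by apply: filterS2 H Hg => s -> ->.
Qed.

Lemma traj_concat T T' c c' : 0 < T -> 0 < T' -> traj T c -> traj T' c' -> c T = c' 0 ->
  ~ KS_vertex n (c' 0).1 -> traj (T + T') (concat T c c').
Proof.
move=> T0 T'0 [R1 L1 S1 V1] [R2 L2 S2 V2] E nv.
have lo t : t <= T -> concat T c c' t = c t.
  rewrite /concat; case: ltrgtP => // tT _; by rewrite tT subrr E.
have hi t : T <= t -> concat T c c' t = c' (t - T) by rewrite /concat ltNge => ->.
split=> t /andP[t0 t1].
- have [tT|tT] := ltP t T.
    apply: (@glide_right_eq _ c t t); [by rewrite lo // ltW| |by apply: R1; rewrite t0].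
    apply/near0P; exists (T - t); first by rewrite subr_gt0.
    by move=> s /andP[s0 s1]; rewrite lo //; lra.
  apply: (@glide_right_eq _ c' t (t - T)); first by rewrite hi.
    apply/near0P; exists 1 => // s /andP[s0 s1].
    have -> : t - T + s = t + s - T by rewrite addrAC.
    by apply: hi; lra.
  by apply: R2; apply/andP; split; lra.
- have [tT|tT] := leP t T.
    apply: (@glide_left_eq _ c t t); [by rewrite lo| |by apply: L1; rewrite t0].
    by apply/near0P; exists 1 => // s /andP[s0 s1]; rewrite lo //; lra.
  apply: (@glide_left_eq _ c' t (t - T)); first by rewrite hi // ltW.
    apply/near0P; exists (t - T); first by rewrite subr_gt0.
    move=> s /andP[s0 s1].
    have -> : t - T - s = t - s - T by rewrite addrAC.
    by apply: hi; lra.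
  by apply: L2; apply/andP; split; lra.
- have [tT|tT] := leP t T; first by rewrite lo //; apply: S1; rewrite t0.
  by rewrite hi ?ltW //; apply: S2; apply/andP; split; lra.
- have [tT|tT] := ltP t T; first by rewrite lo ?ltW //; apply: V1; rewrite t0.
  rewrite hi //; have [E0|ne] := eqVneq (t - T) 0; first by rewrite E0.
  have : 0 < t - T by rewrite lt_neqAle eq_sym ne subr_ge0.
  by move=> h; apply: V2; rewrite h /=; lra.
Qed.

Lemma reach_trans z1 z2 z3 : reach z1 z2 -> ~ KS_vertex n z2.1 -> reach z2 z3 -> reach z1 z3.
Proof.
move=> [T [c [T0 c0 cT Hc]]] nv [T' [c' [T'0 c'0 cT' Hc']]].
exists (T + T'), (concat T c c'); split.
- exact: addr_gt0.
- by rewrite /concat T0.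
- by rewrite /concat ltNge lerDl (ltW T'0) /= [T + _]addrC addrK.
- by apply: traj_concat => //; rewrite ?cT ?c'0.
Qed.

Lemma reach_flight x g (t : R) z' : 0 < t -> D3 n g -> D3 n z'.2 ->
  (forall t', 0 <= t' <= t -> Omega n (x + t' *: (invmx g *m v))) ->
  (forall t', 0 < t' < t -> ~ KS_vertex n (x + t' *: (invmx g *m v))) ->
  z'.1 = x + t *: (invmx g *m v) -> surface_eq n z' (z'.1, g) ->
  reach (x, g) z'.
Proof.
move=> t0 Dg Dz' HO HV z'E Sz'; set u := invmx g *m v in HO HV z'E.
pose c t' := if t' < t then (x + t' *: u, g) else z'.
have lo t' : t' < t -> c t' = (x + t' *: u, g) by rewrite /c => ->.
have ct : c t = z' by rewrite /c ltxx.
exists t, c; split=> //; first by rewrite lo // scale0r addr0.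
split=> t' /andP[a b].
- rewrite /glide_right lo //; apply/near0P; exists (t - t'); first by rewrite subr_gt0.
  move=> s /andP[s0 s1]; rewrite lo; last lra.
  by rewrite /= /heading /= scalerDl addrA.
- move: b; rewrite le_eqVlt => /predU1P[->|b].
    exists g; rewrite ct; split=> //; apply/near0P; exists 1 => // s /andP[s0 s1].
    by rewrite lo ?z'E; [rewrite scalerBl addrA|lra].
  exists g; rewrite lo //=; split=> //; first exact: surface_eq_refl.
  apply/near0P; exists 1 => // s /andP[s0 s1].
  by rewrite lo; [rewrite scalerBl addrA|lra].
- move: b; rewrite le_eqVlt => /predU1P[->|b].
    by rewrite ct; split=> //; rewrite z'E; apply: HO; rewrite (ltW t0) lexx.
  by rewrite lo //; split=> //=; apply: HO; rewrite a ltW.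
- by rewrite lo //=; apply: HV; rewrite a.
Qed.

Lemma traj_saddle (T T1 : R) c : traj T c -> 0 <= T1 < T -> KS_vertex n (c 0).1 ->
  KS_vertex n (c T).1 ->
  glide_right (fun t => c (t + T1)) 0 /\
  saddle_connection n v (- T1) (T - T1) (fun t => c (t + T1)).
Proof.
move=> [Rc Lc Sc Vc] /andP[T10 T1T] V0 VT.
have shr t : glide_right c (t + T1) -> glide_right (fun t => c (t + T1)) t.
  by apply: glide_right_eq => //; near=> s; rewrite addrAC.
have shl t : glide_left c (t + T1) -> glide_left (fun t => c (t + T1)) t.
  by apply: glide_left_eq => //; near=> s; rewrite addrAC.
split; first by apply: shr; apply: Rc; rewrite add0r T10.
split.
- apply: glide_geodesic => [t|t t'|t t']; rewrite /= !in_itv /= => /andP[a b].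
  + by apply: Sc; apply/andP; split; lra.
  + by move=> /andP[a' b'] tt'; apply: shr; apply: Rc; apply/andP; split; lra.
  + by move=> /andP[a' b'] tt'; apply: shl; apply: Lc; apply/andP; split; lra.
- by rewrite addNr.
- by rewrite subrK.
- by move=> t /andP[a b]; apply: Vc; apply/andP; split; lra.
Unshelve. all: by end_near. Qed.

Lemma reach_saddle z0 z z1 : reach z0 z -> ~ KS_vertex n z.1 -> reach z z1 ->
  KS_vertex n z0.1 -> KS_vertex n z1.1 ->
  exists c, [/\ c 0 = z, glide_right c 0 &
    exists a b : R, a <= 0 < b /\ saddle_connection n v a b c].
Proof.
move=> [T [c [T0 c0 cT Hc]]] nv [T' [c' [T'0 c'0 cT' Hc']]] V0 V1.
have Tr : traj (T + T') (concat T c c') by apply: traj_concat => //; rewrite ?cT ?c'0.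
have [] := traj_saddle (T1 := T) Tr.
- by rewrite (ltW T0) ltrDl.
- by rewrite /concat T0 c0.
- by rewrite /concat ltNge lerDl (ltW T'0) /= [T + _]addrC addrK cT'.
move=> H1 H2; eexists; split; [|exact: H1|].
  by rewrite /= add0r /concat ltxx subrr.
by exists (- T), (T + T' - T); split=> //; rewrite oppr_le0 (ltW T0) [T + _]addrC addrK.
Qed.

Lemma reach_saddle0 z z1 : reach z z1 -> KS_vertex n z.1 -> KS_vertex n z1.1 ->
  exists c, [/\ c 0 = z, glide_right c 0 &
    exists a b : R, a <= 0 < b /\ saddle_connection n v a b c].
Proof.
move=> [T [c [T0 c0 cT Hc]]] V0 V1.
have [] := traj_saddle (T1 := 0) Hc; rewrite ?lexx ?T0 ?c0 ?cT //.
move=> H1 H2; eexists; split; [|exact: H1|]; first by rewrite /= add0r.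
by exists (- 0), (T - 0); split=> //; rewrite oppr0 addr0 lexx.
Qed.

Definition frac (T t : R) : R := t - T * (Num.floor (t / T))%:~R.

Lemma frac_itv T t : 0 < T -> 0 <= frac T t < T.
Proof.
move=> T0; rewrite /frac; have := floor_itv (t / T).
rewrite rmorphD /= => /andP[a b].
have : T * (Num.floor (t / T))%:~R <= t by rewrite mulrC -ler_pdivlMr.
have : t < T * ((Num.floor (t / T))%:~R + 1) by rewrite mulrC -ltr_pdivrMr.
by rewrite mulrDr mulr1 => *; apply/andP; split; lra.
Qed.

Lemma fracP (T t f : R) (m : int) : 0 < T -> t = f + T * m%:~R -> 0 <= f < T -> frac T t = f.
Proof.
move=> T0 -> /andP[f0 fT]; rewrite /frac.
have -> : Num.floor ((f + T * m%:~R) / T) = m; last by rewrite addrK.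
apply: floor_def; rewrite mulrDl [T * _]mulrC mulfK ?gt_eqF // rmorphD /=.
have : 0 <= f / T by rewrite divr_ge0 // ltW.
have : f / T < 1 by rewrite ltr_pdivrMr // mul1r.
by move=> *; apply/andP; split; lra.
Qed.

(** Extend by periodicity: at the multiples of T the closed trajectory is left
    as at time 0, and reached as at time T. *)
Lemma reach_periodic z : reach z z -> ~ KS_vertex n z.1 ->
  exists c, [/\ c 0 = z, glide_right c 0 & periodic_geodesic n v c].
Proof.
move=> [T [c [T0 c0 cT [Rc Lc Sc Vc]]]] nv.
pose c' t := c (frac T t).
have tE t : t = frac T t + T * (Num.floor (t / T))%:~R by rewrite /frac subrK.
have Hr t : glide_right c' t.
  have /andP[a b] := frac_itv t T0.
  apply: (@glide_right_eq _ c t (frac T t)) => //; last by apply: Rc; rewrite a.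
  apply/near0P; exists (T - frac T t); first by rewrite subr_gt0.
  move=> s /andP[s0 s1]; rewrite /c'; congr c.
  apply: (fracP (m := Num.floor (t / T))) => //; first by rewrite {1}(tE t); ring.
  by apply/andP; split; lra.
have Hl t : glide_left c' t.
  have /andP[a b] := frac_itv t T0.
  move: a; rewrite le_eqVlt => /predU1P[E|a].
    apply: (@glide_left_eq _ c t T); first by rewrite /c' -E c0 cT.
      apply/near0P; exists T => // s /andP[s0 s1]; rewrite /c'; congr c.
      apply: (fracP (m := Num.floor (t / T) - 1)) => //.
        by rewrite {1}(tE t) -E rmorphB /=; ring.
      by apply/andP; split; lra.
    by apply: Lc; rewrite T0 lexx.
  apply: (@glide_left_eq _ c t (frac T t)) => //; last by apply: Lc; rewrite a ltW.
  apply/near0P; exists (frac T t) => // s /andP[s0 s1]; rewrite /c'; congr c.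
  apply: (fracP (m := Num.floor (t / T))) => //; first by rewrite {1}(tE t); ring.
  by apply/andP; split; lra.
exists c'; split=> //.
  by rewrite /c' (@fracP T 0 0 0) ?c0 ?lexx // mulr0 addr0.
split.
- apply: glide_geodesic => // t _; have /andP[a b] := frac_itv t T0.
  by apply: Sc; rewrite a ltW.
- move=> t; have /andP[a b] := frac_itv t T0; rewrite /c'.
  move: a; rewrite le_eqVlt => /predU1P[<-|a]; first by rewrite c0.
  by apply: Vc; rewrite a.
- exists T => // t; rewrite /c'.
  have -> : frac T (t + T) = frac T t.
    apply: (fracP (m := Num.floor (t / T) + 1)) => //; last exact: frac_itv.
    by rewrite {1}(tE t) rmorphD /=; ring.
  exact: surface_eq_refl.
Qed.

End Trajectories.

(** * Rational directions are closed *)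

Section RationalClosed.
Context {R : realType}.
Implicit Types (n : nat) (p q u v w x y : 'cV[R]_2) (g r : 'M[R]_2).
Implicit Types (s : 'cV[R]_2 * 'cV[R]_2) (z : 'cV[R]_2 * 'M[R]_2).

Lemma rational_billiard_closed n v : v != 0 -> rational v -> billiard_closed n v.
Proof.
move=> v0 rv x Kx Ix.
have D1 : D3 n (1%:M : 'M[R]_2) by apply: generated_one.
have h1 y : heading v (y, 1%:M) = v by rewrite /heading /= invmx1 mul1mx.
have Sz : state n v (x, 1%:M) by split=> //; rewrite h1.
pose F z := (z.1, heading v z).
have FE z z' : bounce n v z z' -> billiard_map n (F z) (F z').
  move=> [[Kz Dz Iz] hz nv [s [sS sz' E]]]; split=> //; exists s; split=> //.
  case: z' E {hz nv sz'} => x' g' /= ->; case: z Dz {Kz Iz} => x0 g Dz.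
  exact: (@heading_refl _ n v x' x0 g s Dz sS).
case: (orbit_dichotomy v0 rv Sz) => [[orb [N [N0 o0 oE oN fin]]]|].
  left; exists (F \o orb); split=> [|k|]; first by rewrite /= o0 /F h1.
    exact/FE/oE.
  apply: (@sub_finite_set _ _ (F @` range orb)); last exact: finite_image.
  by move=> _ [k _ <-]; exists (orb k) => //; exists k.
move=> [m [j [orb [[jm oj] V0 oE [_ [y hy Vy]]]]]].
right; exists m, j, (F \o orb); split=> //.
- by rewrite /= oj /F h1.
- by move=> k km; apply/FE/oE.
- by exists y.
Qed.

(** The times at which a line is in the segment form an interval. *)
Lemma ray_side_dichotomy p u s : (\forall t \near 0^'+, side_set s (p + t *: u)) \/
  (\forall t \near 0^'+, ~ side_set s (p + t *: u)).
Proof.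
have conv t1 t2 t : 0 < t1 -> t1 <= t <= t2 -> side_set s (p + t1 *: u) ->
    side_set s (p + t2 *: u) -> side_set s (p + t *: u).
  move=> t10 /andP[a b] S1 S2; have [E|ne] := eqVneq t1 t2.
    have -> // : t = t1 by apply/eqP; rewrite eq_le a E b.
  have d0 : 0 < t2 - t1 by rewrite subr_gt0 lt_neqAle ne; lra.
  pose l := (t - t1) / (t2 - t1).
  have l0 : 0 <= l by apply: divr_ge0; lra.
  have l1 : l <= 1 by rewrite ler_pdivrMr // mul1r lerB.
  have tE : t = (1 - l) * t1 + l * t2 by rewrite /l; field; rewrite gt_eqF.
  case: S1 => al /andP[al0 al1] E1; case: S2 => be /andP[be0 be1] E2.
  exists ((1 - l) * al + l * be).
    have := mulr_ge0 l0 be0; have := ler_wpM2l l0 be1.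
    have l2 : 0 <= 1 - l by rewrite subr_ge0.
    have := mulr_ge0 l2 al0; have := ler_wpM2l l2 al1.
    by rewrite !mulr1 => *; apply/andP; split; lra.
  have -> : p + t *: u = (1 - l) *: (p + t1 *: u) + l *: (p + t2 *: u).
    by rewrite tE; apply: vec_ext; rewrite !cE; ring.
  by rewrite E1 E2; apply: vec_ext; rewrite !cE; ring.
have [[e e0 He]|N] := pselect (exists2 e : R, 0 < e & forall t, 0 < t < e -> ~ side_set s (p + t *: u)).
  by right; apply/near0P; exists e.
left; have ex (e : R) : 0 < e -> exists2 t, 0 < t < e & side_set s (p + t *: u).
  move=> e0; apply: contrapT => H; apply: N; exists e => // t te S; apply: H.
  by exists t.
have [t1 /andP[t10 _] S1] := ex 1 ltr01.
apply/near0P; exists t1 => // t /andP[t0 tt1]; have [t2 /andP[t20 t2t] S2] := ex t t0.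
by apply: (conv t2 t1) => //; rewrite !ltW.
Qed.

Lemma ray_KS_dichotomy n p u : (\forall t \near 0^'+, ~ KS n (p + t *: u)) \/
  (exists2 s, s \in KS_sides n & \forall t \near 0^'+, side_set s (p + t *: u)).
Proof.
have [[s sS H]|N] := pselect (exists2 s, s \in KS_sides n & \forall t \near 0^'+, side_set s (p + t *: u)).
  by right; exists s.
left; have : forall s, s \in KS_sides n -> \forall t \near 0^'+, ~ side_set s (p + t *: u).
  by move=> s sS; have [H|//] := ray_side_dichotomy p u s; case: N; exists s.
rewrite /KS; elim: (KS_sides n) => [|s S IH] H; first by near=> t => -[].
have H1 := H s (mem_head _ _).
have {}IH := IH (fun s' s'S => H s' (mem_behead (s := s :: S) s'S)).
apply: filterS2 H1 IH => t H1 H2 [s']; rewrite inE => /predU1P[->//|s'S h].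
by apply: H2; exists s'.
Unshelve. all: by end_near. Qed.

(** The bounds on a hold because p is a limit of points of the side, and are
    strict on the side towards which the ray moves, as it stays in the side. *)
Lemma side_ray p u s : s.2 != s.1 -> u != 0 ->
  (\forall t \near 0^'+, side_set s (p + t *: u)) ->
  exists a b : R, [/\ b != 0, p = s.1 + a *: (s.2 - s.1), u = b *: (s.2 - s.1) &
    [/\ 0 <= a <= 1, 0 < b -> a < 1 & b < 0 -> 0 < a]].
Proof.
move=> s0 u0 /near0P[e e0 He]; set d := s.2 - s.1.
have d0 : d != 0 by rewrite subr_eq0.
have [|t1 t101 E1] := He (e / 2); first by apply/andP; split; lra.
have [|t2 t201 E2] := He (e / 4); first by apply/andP; split; lra.
(* a and b are read off from the points at the times e / 2 and e / 4 *)
rewrite -/d in E1 E2; pose b := (t1 - t2) * (4 / e); pose a := 2 * t2 - t1.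
have en : e != 0 by rewrite gt_eqF.
have uE : u = b *: d.
  have : (e / 4) *: u = (t1 - t2) *: d.
    have -> : (e / 4) *: u = (p + (e / 2) *: u) - (p + (e / 4) *: u).
      by apply: vec_ext; rewrite !cE; field.
    by rewrite E1 E2; apply: vec_ext; rewrite !cE; ring.
  move=> E; rewrite /b mulrC -scalerA -E scalerA.
  have -> : 4 / e * (e / 4) = 1 by field.
  by rewrite scale1r.
have pE : p = s.1 + a *: d.
  have -> : p = 2 *: (p + (e / 4) *: u) - (p + (e / 2) *: u).
    by apply: vec_ext; rewrite !cE; field.
  by rewrite E1 E2 /a; apply: vec_ext; rewrite !cE; ring.
have b0 : b != 0 by apply: contra u0 => /eqP b0; rewrite uE b0 scale0r.
have H t : 0 < t < e -> 0 <= a + t * b <= 1.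
  move=> /He[t' t'01]; rewrite -/d pE uE scalerA -addrA -scalerDl => /addrI.
  by move=> /eqP; rewrite -subr_eq0 -scalerBl scaler_eq0 (negPf d0) orbF subr_eq0 => /eqP ->.
exists a, b; split=> //.
have small (f : R) : 0 < f -> exists t, [/\ 0 < t, t < e, - f < t * b & t * b < f].
  move=> f0; have nb : 0 < `|b| by rewrite normr_gt0.
  pose m := Num.min e (f / `|b|).
  have m0 : 0 < m by rewrite lt_min e0 divr_gt0.
  have m1 : m <= e by rewrite ge_min lexx.
  have m2 : m * `|b| <= f by rewrite -ler_pdivlMr // ge_min lexx orbT.
  exists (m / 2); have : `|m / 2 * b| < f.
    rewrite normrM gtr0_norm ?divr_gt0 // mulrAC.
    have : 0 < m * `|b| by rewrite mulr_gt0.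
    by lra.
  by rewrite ltr_norml => /andP[h1 h2]; split=> //; lra.
have a0 : 0 <= a.
  rewrite leNgt; apply/negP => an; have [|t [t0 te h1 h2]] := small (- a); first lra.
  by have /andP[h _] := H t (introT andP (conj t0 te)); lra.
have a1 : a <= 1.
  rewrite leNgt; apply/negP => an; have [|t [t0 te h1 h2]] := small (a - 1); first lra.
  by have /andP[_ h] := H t (introT andP (conj t0 te)); lra.
have e2 : 0 < e / 2 < e by apply/andP; split; lra.
have /andP[h1 h2] := H _ e2.
split; [by rewrite a0| |] => bs.
  have : 0 < e / 2 * b by rewrite mulr_gt0 // divr_gt0.
  lra.
have : 0 < e / 2 * (- b) by rewrite mulr_gt0 ?divr_gt0 // oppr_gt0.
by rewrite mulrN; lra.
Qed.

(** The trajectory stays on the side and in the same sheet between the two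
    vertices, and passes p at time 0. *)
Lemma side_saddle n p r s u v (a b : R) : s \in KS_sides n -> D3 n r ->
  u = invmx r *m v -> b != 0 -> p = s.1 + a *: (s.2 - s.1) -> u = b *: (s.2 - s.1) ->
  0 <= a <= 1 -> (0 < b -> a < 1) -> (b < 0 -> 0 < a) ->
  exists t0 t1 : R, t0 <= 0 < t1 /\
    saddle_connection n v t0 t1 (fun t => (p + t *: u, r)).
Proof.
move=> sS Dr uv b0 pE uE /andP[a0 a1] bpos bneg; have [V1 V2] := side_vertex sS.
set d := s.2 - s.1 in pE uE.
have pos t : p + t *: u = s.1 + (a + t * b) *: d.
  by rewrite pE uE scalerA scalerDl addrA.
have end0 : s.1 + 0 *: d = s.1 by rewrite scale0r addr0.
have end1 : s.1 + 1 *: d = s.2 by rewrite scale1r /d addrC subrK.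
have main t0 t1 : (forall t, t0 <= t <= t1 -> 0 <= a + t * b <= 1) ->
    (forall t, t0 < t < t1 -> 0 < a + t * b < 1) ->
    KS_vertex n (p + t0 *: u) -> KS_vertex n (p + t1 *: u) ->
    saddle_connection n v t0 t1 (fun t => (p + t *: u, r)).
  move=> H1 H2 W0 W1; split=> //.
  - move=> t; rewrite /= in_itv /= => tI; split.
      by split=> //=; left; exists s => //; rewrite pos; exists (a + t * b) => //; apply: H1.
    exists 1 => // t' _ _; exists r; split=> //=; try exact: surface_eq_refl.
    rewrite opprD addrACA subrr add0r -scalerBl -scalemxAr uv mulKVmx //.
    exact: D3_unit Dr.
  - move=> t tI /= /vertex_lat; rewrite pos.
    exact: edge_inner01 (sides_edge sS) (H2 t tI).
have [bp|bn] : 0 < b \/ b < 0 by apply/orP; rewrite orbC -neq_lt.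
  exists (- a / b), ((1 - a) / b); split.
    by rewrite mulNr oppr_le0 divr_ge0 ?(ltW bp) // divr_gt0 // subr_gt0 bpos.
  apply: main => [t|t||].
  - rewrite ler_pdivrMr // ler_pdivlMr // => /andP[h1 h2]; apply/andP; split; lra.
  - rewrite ltr_pdivrMr // ltr_pdivlMr // => /andP[h1 h2]; apply/andP; split; lra.
  - by rewrite pos divfK // subrr end0.
  - by rewrite pos divfK // [a + _]addrC subrK end1.
exists ((1 - a) / b), (- a / b); split.
  by rewrite ler_ndivrMr // ltr_ndivlMr // !mul0r; have := bneg bn; move=> ?; apply/andP; split; lra.
apply: main => [t|t||].
- rewrite ler_ndivrMr // ler_ndivlMr // => /andP[h1 h2]; apply/andP; split; lra.
- rewrite ltr_ndivrMr // ltr_ndivlMr // => /andP[h1 h2]; apply/andP; split; lra.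
- by rewrite pos divfK // [a + _]addrC subrK end1.
- by rewrite pos divfK // subrr end0.
Qed.

(** As [bounce], except that z' may be at a vertex, where the final sheet is only
    required to represent the same point of the surface. *)
Definition flight n v z z' : Prop := [/\ state n v z, first_hit n z.1 (heading v z) z'.1,
  D3 n z'.2 & surface_eq n z' (z'.1, z.2)].

Lemma bounce_flight n v z z' : v != 0 -> bounce n v z z' -> flight n v z z'.
Proof.
move=> v0 B; have [_ Dz' _] := bounce_state v0 B; have [Sz hz nv [s [sS sz' E]]] := B.
split=> //; split=> //; constructor 2; exists s; split=> //=.
have [_ Dz _] := Sz.
rewrite E invmxM ?(D3_unit Dz) ?(D3_unit (D3_refl sS)) //.
by rewrite mulmxKV ?(D3_unit Dz) // (refl_inv sS).
Qed.

(** A trajectory may start inside the region, at some time f > 0 after the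
    last bounce; it is inserted in the orbit of this bounce. *)
Lemma flight_split n v z z' p (f : R) : v != 0 -> flight n v z z' -> 0 <= f ->
  p = z.1 + f *: heading v z ->
  (forall t, 0 < t <= f -> ~ KS n (z.1 + t *: heading v z)) ->
  reach n v (p, z.2) z' /\ (0 < f -> reach n v z (p, z.2)).
Proof.
move=> v0 [[Kz Dz Iz] hz Dz' Sz'] f0 pE nK; set u := heading v z in hz pE nK Iz.
have u0 : u != 0 by apply: heading_neq0 Dz.
have [T [T0 z'E Kz' HT]] := first_hit_Omega u0 Iz hz.
have fT : f < T.
  by rewrite ltNge; apply/negP => Tf; apply: (nK T); rewrite ?T0 // -z'E.
have HO t : 0 <= t <= T -> Omega n (z.1 + t *: u).
  move=> /andP[]; rewrite le_eqVlt => /predU1P[<- _|t0]; first by left; rewrite scale0r addr0.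
  by rewrite le_eqVlt => /predU1P[->|tT]; [left; rewrite -z'E|case: (HT t); rewrite ?t0].
have HV t : 0 < t < T -> ~ KS_vertex n (z.1 + t *: u) by move=> /HT[_ h] /vertex_KS.
have shift t : p + t *: u = z.1 + (f + t) *: u by rewrite pE scalerDl addrA.
split.
  apply: (@reach_flight _ n v p z.2 (T - f)); rewrite -/u ?subr_gt0 //.
  - by move=> t /andP[a b]; rewrite shift; apply: HO; apply/andP; split; lra.
  - by move=> t /andP[a b]; rewrite shift; apply: HV; apply/andP; split; lra.
  - by rewrite shift z'E [f + _]addrC subrK.
move=> fpos; rewrite {1}[z]surjective_pairing.
apply: (@reach_flight _ n v z.1 z.2 f); rewrite -/u //=.
- by move=> t /andP[a b]; apply: HO; apply/andP; split; lra.
- by move=> t /andP[a b]; apply: HV; apply/andP; split; lra.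
- exact: surface_eq_refl.
Qed.

Lemma flight_reach n v z z' : v != 0 -> flight n v z z' -> reach n v z z'.
Proof.
move=> v0 F; rewrite [z]surjective_pairing.
have [] := @flight_split n v z z' z.1 0 v0 F (lexx _) _ _ => //.
  by rewrite scale0r addr0.
by move=> t /andP[a b]; lra.
Qed.

Lemma flight_chain n v (orb : nat -> 'cV[R]_2 * 'M[R]_2) i j : v != 0 -> (i < j)%N ->
  (forall k, (i <= k < j)%N -> flight n v (orb k) (orb k.+1)) ->
  (forall k, (i < k < j)%N -> ~ KS_vertex n (orb k).1) ->
  reach n v (orb i) (orb j).
Proof.
move=> v0; elim: j => // j IH; rewrite ltnS leq_eqVlt => /predU1P[->|ij] F V.
  by apply: flight_reach => //; apply: F; rewrite leqnn ltnSn.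
apply: (@reach_trans _ n v _ (orb j)).
- apply: IH => // k /andP[a b]; [apply: F|apply: V]; by rewrite a ltnS ltnW.
- by apply: V; rewrite ij ltnSn.
- by apply: flight_reach => //; apply: F; rewrite ltnW //= ltnSn.
Qed.

(** The flights of the orbit of z are concatenated from and back to p if the
    orbit is a cycle, and otherwise from its first vertex through p to the
    last one. *)
Lemma orbit_geodesic n v z p (f : R) : v != 0 -> rational v -> state n v z -> 0 <= f ->
  p = z.1 + f *: heading v z ->
  (forall t, 0 < t <= f -> ~ KS n (z.1 + t *: heading v z)) ->
  exists c, [/\ c 0 = (p, z.2), glide_right v c 0 &
    periodic_geodesic n v c \/
    exists a b : R, a <= 0 < b /\ saddle_connection n v a b c].
Proof.
move=> v0 rv Sz f0 pE nK.
have pz : f = 0 -> (p, z.2) = z.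
  by move=> f00; rewrite pE f00 scale0r addr0 -surjective_pairing.
have pv : 0 < f -> ~ KS_vertex n p.
  by move=> fp /vertex_KS; rewrite pE; apply: nK; rewrite fp lexx.
have f01 : f = 0 \/ 0 < f.
  by move: f0; rewrite le_eqVlt => /predU1P[<-|]; [left|right].
case: (orbit_dichotomy v0 rv Sz) => [[orb [N [N0 o0 oE oN _]]]|].
  have V k : ~ KS_vertex n (orb k.+1).1 by have [] := oE k.
  have F k : flight n v (orb k) (orb k.+1) by apply: bounce_flight.
  have zv : ~ KS_vertex n z.1 by rewrite -o0 -(oN 0%N) add0n -(prednK N0).
  have := F 0%N; rewrite o0 => F0.
  have [Rp Rz] := flight_split v0 F0 f0 pE nK.
  have R1 : reach n v (p, z.2) z.
    have oNz : orb N = z by rewrite -o0 -(oN 0%N).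
    case: N N0 oNz {oN} => // -[|N] _ oNz; first by rewrite -{2}oNz.
    apply: reach_trans Rp (V _) _; rewrite -oNz.
    by apply: flight_chain => // -[].
  have [fz|fp] := f01.
    have pzz := pz fz; rewrite pzz in R1 *.
    have [c [c0 gc pc]] := reach_periodic R1 zv.
    by exists c; split=> //; left.
  have [c [c0 gc pc]] := reach_periodic (reach_trans R1 zv (Rz fp)) (pv fp).
  by exists c; split=> //; left.
move=> [m [j [orb [[jm oj] V0 oE [_ [y hy Vy]]]]]].
(* the final vertex is added to the orbit, in the sheet of the last flight *)
pose orb' k := if (k <= m)%N then orb k else (y, (orb m).2).
have lo k : (k <= m)%N -> orb' k = orb k by rewrite /orb' => ->.
have hi : orb' m.+1 = (y, (orb m).2) by rewrite /orb' ltnn.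
have V k : (0 < k <= m)%N -> ~ KS_vertex n (orb' k).1.
  by move=> /andP[k0 km]; rewrite lo // -(prednK k0); have [] := oE k.-1; rewrite ?prednK.
have So k : (k <= m)%N -> state n v (orb k).
  move=> km; have [kj|jk] := ltnP k j.
    by have [] := oE k (leq_trans kj jm).
  move: jk; rewrite leq_eqVlt => /predU1P[<-|jk]; first by rewrite oj.
  have k0 : (0 < k)%N by apply: leq_ltn_trans jk.
  have := oE k.-1; rewrite prednK // => /(_ km); exact: bounce_state.
have F k : (k <= m)%N -> flight n v (orb' k) (orb' k.+1).
  move=> km; rewrite lo //; move: (km); rewrite leq_eqVlt => /predU1P[->|km'].
    rewrite hi; have [K D I] := So m (leqnn _).
    by split=> //=; exact: surface_eq_refl.
  by rewrite lo //; apply: bounce_flight => //; apply: oE.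
have Fj := F _ jm; rewrite (lo _ jm) oj in Fj.
have [Rp Rz] := flight_split v0 Fj f0 pE nK.
have Rend : reach n v (p, z.2) (orb' m.+1).
  move: (jm); rewrite leq_eqVlt => /predU1P[<-//|jm'].
  apply: reach_trans Rp (V _ _) _; first by rewrite ltn0Sn.
  by apply: flight_chain => // k /andP[a b]; [apply: F|apply: V; rewrite (ltn_trans _ a)].
have Vend : KS_vertex n (orb' m.+1).1 by rewrite hi.
have V0' : KS_vertex n (orb' 0%N).1 by rewrite lo.
case: j jm oj Fj Rp => [|j] jm oj Fj Rp.
  have z0 : orb' 0%N = z by rewrite lo.
  rewrite z0 in V0'; have [fz|fp] := f01.
    have pzz := pz fz; rewrite pzz in Rend *.
    have [c [c0 gc pc]] := reach_saddle0 Rend V0' Vend.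
    by exists c; split=> //; right.
  have [c [c0 gc pc]] := reach_saddle (Rz fp) (pv fp) Rend V0' Vend.
  by exists c; split=> //; right.
have Rj : reach n v (orb' 0%N) z.
  rewrite -oj -(lo _ jm); apply: flight_chain => // k /andP[a b].
    by apply: F; rewrite (leq_trans (ltnW b)).
  by apply: V; rewrite a (leq_trans (ltnW b)).
have zv : ~ KS_vertex n z.1 by rewrite -oj -(lo _ jm); apply: V; rewrite jm.
have [fz|fp] := f01.
  have pzz := pz fz; rewrite pzz in Rend *.
  have [c [c0 gc pc]] := reach_saddle Rj zv Rend V0' Vend.
  by exists c; split=> //; right.
have [c [c0 gc pc]] := reach_saddle (reach_trans Rj zv (Rz fp)) (pv fp) Rend V0' Vend.
by exists c; split=> //; right.
Qed.

(** The initial ray runs along a side, or starts inside; in the latter case p is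
    reached from the state obtained by tracing the ray back to KS_n. *)
Lemma rational_geodesic_closed n v : v != 0 -> rational v -> geodesic_flow_closed n v.
Proof.
move=> v0 rv p r [/= Op Dr] Hn.
pose u := invmx r *m v; have u0 : u != 0 by apply: (heading_neq0 (z := (p, r)) v0 Dr).
have from c : c 0 = (p, r) -> glide_right v c 0 ->
    \forall t \near 0^'+, surface_eq n (c t) (p + t *: u, r).
  move=> c0; apply: filterS => t; rewrite add0r c0 => ->; exact: surface_eq_refl.
have [nK|[s sS Hs]] := ray_KS_dichotomy n p u; last first.
  have [a [b [b0 pE uE [a01 bp bn]]]] := side_ray (edge_neq (sides_edge sS)) u0 Hs.
  have [t0 [t1 [t01 Sad]]] := side_saddle sS Dr (erefl u) b0 pE uE a01 bp bn.
  exists (fun t => (p + t *: u, r)); split.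
  - rewrite scale0r addr0; exact: surface_eq_refl.
  - by near=> t; apply: surface_eq_refl.
  - by right; exists t0, t1.
have Ip : inward n p u by apply: filterS2 Hn nK => t.
suff [z [f [Sz z2 f0 pE H]]] : exists z (f : R), [/\ state n v z, z.2 = r, 0 <= f,
    p = z.1 + f *: u & forall t, 0 < t <= f -> ~ KS n (z.1 + t *: u)].
  have uz : heading v z = u by rewrite /heading z2.
  rewrite -uz in pE H; have [c [c0 gc Hc]] := orbit_geodesic v0 rv Sz f0 pE H.
  rewrite z2 in c0; exists c; split=> //; last exact: from.
  rewrite c0; exact: surface_eq_refl.
have [Kp|Kp] := pselect (KS n p).
  exists (p, r), 0; split=> //; first by rewrite scale0r addr0.
  by move=> t /andP[a b]; lra.
have mu0 : - u != 0 by rewrite oppr_eq0.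
have [f [f0 Kf Hf]] := first_hit_ex mu0 (conj Op Kp).
have back t : p + f *: (- u) + t *: u = p + (f - t) *: (- u).
  by apply: vec_ext; rewrite !cE; ring.
have Hb t : 0 < t <= f -> (Omega n `\` KS n) (p + f *: (- u) + t *: u).
  by move=> /andP[a b]; rewrite back; apply: Hf; apply/andP; split; lra.
exists (p + f *: (- u), r), f; split=> //=.
- split=> //; apply/near0P; exists f => // t /andP[a b]; apply: Hb.
  by rewrite a ltW.
- exact: ltW.
- by rewrite scalerN subrK.
- by move=> t /Hb[].
Unshelve. all: by end_near. Qed.

End RationalClosed.

(** * Closed directions are rational *)

Section ClosedRational.
Context {R : realType}.
Implicit Types (n : nat) (p q u v w x y : 'cV[R]_2) (g r : 'M[R]_2).
Implicit Types (s : 'cV[R]_2 * 'cV[R]_2) (z : 'cV[R]_2 * 'M[R]_2).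

Lemma lat_rational n v (t : R) : t != 0 -> lat n (t *: v) -> rational v.
Proof.
move=> t0 [a [b E]]; exists (3 ^+ n * t); first by rewrite mulf_neq0 ?pow3_neq0.
by exists a, b; rewrite expr0 scale1r -E scalerA.
Qed.

Lemma near0_Omega n p u : (Omega n `\` KS n) p ->
  \forall t \near 0^'+, (Omega n `\` KS n) (p + t *: u).
Proof.
move=> [Op nK]; have /near0P[e e0 He] := line_near u (near_KS nK).
apply/near0P; exists e => // t /andP[t0 te]; apply: Omega_ray; rewrite ?(ltW t0) //.
move=> t' /andP[]; rewrite le_eqVlt => /predU1P[<- _|t'0 t't].
  by rewrite scale0r addr0.
by apply: He; rewrite t'0 (le_lt_trans t't).
Qed.

Lemma inward_ex n v : v != 0 -> exists2 x, KS n x & inward n x v.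
Proof.
move=> v0; have [q [Oq nK]] := @Omega_interior R n.
have m0 : - v != 0 by rewrite oppr_eq0.
have [f [f0 Kf Hf]] := first_hit_ex m0 (conj Oq nK).
exists (q + f *: - v) => //; apply/near0P; exists f => // t /andP[t0 tf].
have -> : q + f *: - v + t *: v = q + (f - t) *: - v.
  by apply: vec_ext; rewrite !cE; ring.
by apply: Hf; apply/andP; split; lra.
Qed.

(** Side identifications change the unfolded point by a lattice vector, by
    [unfold_refl]; vertices are lattice points, and unfold to lattice points in
    all sheets. *)
Lemma surface_eq_unfold n z1 z2 : D3 n z1.2 -> surface_eq n z1 z2 ->
  lat n (unfold z2 - unfold z1).
Proof.
case: z1 z2 => [x g1] [_ g2] /= Dg [/= <-]; rewrite /unfold /= => H.
have gU := D3_unit Dg; have g2E : g2 = g1 *m (invmx g1 *m g2) by rewrite mulKVmx.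
have Hg := D3_hexsym Dg.
case: H => [->|[s [sS sx E]]|[s [s' [sS s'S sx s'x G]]]].
- by rewrite subrr; apply: lat0.
- by rewrite g2E E; apply: (unfold_refl Dg sS sx).
- have Lx : lat n x by rewrite -sx; apply: edge_lat2 (sides_edge sS).
  have Hh : hexsym (invmx g1 *m g2).
    by apply: hexsym_gen G => r [->|->];
      [exact: hexsym_refl (sides_edge sS)|exact: hexsym_refl (sides_edge s'S)].
  have Hg2 : hexsym g2 by rewrite g2E; apply: hexsymM.
  case: Hg => _ Hg _; case: Hg2 => _ Hg2 _.
  by apply: latB; apply: hexmap_lat.
Qed.

Lemma flat_disp_unfold n z z' w : surface_pt n z -> surface_pt n z' ->
  flat_disp n z w z' -> lat n (unfold z' - unfold z - w).
Proof.
move=> [_ Dz] [_ Dz'] [r [Dr E1 E2 <-]].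
have L1 := surface_eq_unfold Dz E1; have L2 := surface_eq_unfold Dz' E2.
have := latB L1 L2; rewrite /unfold /= mulmxBr.
by congr (lat n _); apply: vec_ext; rewrite !cE; ring.
Qed.

(** The times which satisfy P form an open and closed part of the segment. *)
Lemma interval_induction (P : R -> Prop) (a b : R) : a <= b -> P a ->
  (forall t, a <= t <= b -> exists2 e : R, 0 < e &
     forall t', a <= t' <= b -> `|t' - t| < e -> P t' <-> P t) -> P b.
Proof.
move=> ab Pa H; pose A := `[a, b]%classic; pose B := A `&` P.
have AE t : A t -> a <= t <= b by rewrite /A /= in_itv.
have Ab : A b by rewrite /A /= in_itv /= ab lexx.
suff : B b by case.
have -> : B = A; last by [].
apply: (@segment_connected R a b).
- by exists a; split=> //; rewrite /A /= in_itv /= lexx ab.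
- exists ((P `|` ~` A)°); first exact: open_interior.
  apply/seteqP; split=> t [At Pt]; split=> //; last first.
    by case: (interior_subset Pt).
  have [e e0 He] := H t (AE _ At).
  exists e => //= t' /= st; case: (pselect (A t')) => As; [left|by right].
  by apply/(He t' (AE _ As)) => //; rewrite distrC.
- exists (closure B); first exact: closed_closure.
  apply/seteqP; split=> t [At Pt]; split=> //; first exact: subset_closure.
  have [e e0 He] := H t (AE _ At).
  have /Pt[t' [[As Ps] st]] : nbhs t (ball t e) by apply: nbhsx_ballx.
  by apply/(He t' (AE _ As)) => //; rewrite distrC.
Qed.

(** The defect is locally constant modulo the lattice. *)
Lemma geodesic_unfold n v (J : set R) c (a b : R) : geodesic n v J c -> a <= b ->
  (forall t, a <= t <= b -> J t) ->
  lat n (unfold (c b) - unfold (c a) - (b - a) *: v).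
Proof.
move=> G ab HJ.
apply: (@interval_induction (fun t => lat n (unfold (c t) - unfold (c a) - (t - a) *: v)) a b) => //.
  by rewrite !subrr scale0r subrr; apply: lat0.
move=> t tI; have [St [e e0 He]] := G t (HJ t tI); exists e => // t' sI se.
have [Ss _] := G t' (HJ t' sI).
have L := flat_disp_unfold St Ss (He t' (HJ t' sI) se).
split=> L'.
  have := latB L' L; congr (lat n _); apply: vec_ext; rewrite !cE; ring.
have := latD L L'; congr (lat n _); apply: vec_ext; rewrite !cE; ring.
Qed.

Lemma geodesic_closed_rational n v : v != 0 -> geodesic_flow_closed n v -> rational v.
Proof.
move=> v0 G; have [q Oq] := @Omega_interior R n.
have D1 : D3 n (1%:M : 'M[R]_2) by apply: generated_one.
have [||c [_ _ [[Gc _ [T T0 HT]]|[a [b [/andP[a0 b0] [Gc Va Vb _]]]]]]] := G q 1%:M.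
- by split=> //=; case: Oq.
- by apply: filterS (near0_Omega (invmx 1%:M *m v) Oq) => t [].
- have L := geodesic_unfold Gc (ltW T0) (fun t _ => I).
  have [ST _] := Gc T I.
  have := surface_eq_unfold ST.2 (_ : surface_eq n (c T) (c 0)).
  have := HT 0; rewrite add0r => E /(_ E) L'.
  apply: (@lat_rational n v T); first by rewrite gt_eqF.
  have := latN (latD L L'); rewrite subr0; congr (lat n _).
  by apply: vec_ext; rewrite !cE; ring.
- have ab : a <= b by apply: le_trans a0 (ltW b0).
  have HJ t : a <= t <= b -> `[a, b]%classic t by rewrite /= in_itv.
  have L := geodesic_unfold Gc ab HJ.
  have [|Sa _] := Gc a; first by rewrite /= in_itv /= lexx ab.
  have [|Sb _] := Gc b; first by rewrite /= in_itv /= lexx ab.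
  have ver z : surface_pt n z -> KS_vertex n z.1 -> lat n (unfold z).
    by move=> [_ /D3_hexsym[_ Hg _]] /vertex_lat; apply: hexmap_lat.
  apply: (@lat_rational n v (b - a)); first by rewrite subr_eq0 gt_eqF // (le_lt_trans a0).
  have := latB (latB (ver _ Sb Vb) (ver _ Sa Va)) L.
  by rewrite subKr.
Qed.

(** The trajectory of z' is, unfolded by g, a continuation of the
    trajectory of z by the time t, up to a lattice vector.  The sheets are not
    part of a state of the billiard map; g records the change of sheet. *)
Definition unfolds_to n (z z' : 'cV[R]_2 * 'cV[R]_2) : Prop :=
  exists g (t : R), [/\ hexsym g, 0 < t, z.2 = g *m z'.2 &
    lat n (g *m z'.1 - z.1 - t *: z.2)].

Implicit Types zz : 'cV[R]_2 * 'cV[R]_2.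

Lemma billiard_unfolds n zz zz' : billiard_map n zz zz' -> unfolds_to n zz zz'.
Proof.
case: zz zz' => [x w] [y w'] [/= Kx Ix [t [t0 yE _ _]] nv [s [sS /= sy /= ->]]].
have es := sides_edge sS; have Hs := hexsym_refl es; have [L _] := es.
exists (side_refl s), t; split=> //=.
  by rewrite mulmxA (refl_invol sS) mul1mx.
have -> : side_refl s *m y - x - t *: w = side_refl s *m y - y.
  by rewrite [X in _ = _ - X]yE opprD addrA.
rewrite (refl_on_side (edge_neq es) sy); apply: latB => //.
by apply: hexmap_lat => //; case: Hs.
Qed.

Lemma unfolds_trans n zz zz' zz'' : unfolds_to n zz zz' -> unfolds_to n zz' zz'' ->
  unfolds_to n zz zz''.
Proof.
move=> [g [t [Hg t0 E L]]] [g' [t' [Hg' t'0 E' L']]].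
exists (g *m g'), (t + t'); split; [exact: hexsymM|exact: addr_gt0|by rewrite -mulmxA -E'|].
have {}L' : lat n (g *m (g' *m zz''.1 - zz'.1 - t' *: zz'.2)).
  by apply: hexmap_lat L'; case: Hg.
have := latD L L'; rewrite !mulmxBr -scalemxAr -E mulmxA.
by congr (lat n _); apply: vec_ext; rewrite !cE; ring.
Qed.

Lemma unfolds_chain n (orb : nat -> 'cV[R]_2 * 'cV[R]_2) i j : (i < j)%N ->
  (forall k, (k < j)%N -> billiard_map n (orb k) (orb k.+1)) -> unfolds_to n (orb i) (orb j).
Proof.
elim: j => // j IH; rewrite ltnS leq_eqVlt => /predU1P[->|ij] H.
  exact/billiard_unfolds/H.
apply: unfolds_trans (billiard_unfolds (H j (leqnn _))).
by apply: IH => // k kj; apply: H; apply: ltnW.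
Qed.

Lemma hexsym_rational g w w' : hexsym g -> w = g *m w' -> rational w <-> rational w'.
Proof.
have half g0 w0 : hexsym g0 -> rational w0 -> rational (g0 *m w0).
  by move=> [_ H _] [c c0 L]; exists c; rewrite // scalemxAr; apply: hexmap_lat.
move=> Hg E; split=> Hw; last by rewrite E; apply: half.
have [gU _ _] := Hg; rewrite -(mulKmx gU w') -E; apply: half => //.
exact: hexsymV.
Qed.

Lemma unfolds_rational n zz zz' : unfolds_to n zz zz' -> rational zz.2 <-> rational zz'.2.
Proof. by move=> [g [t [Hg _ E _]]]; apply: hexsym_rational E. Qed.

(** The loop may come back in another sheet, that is with g not trivial.  But g
    fixes w and has finitely many powers: comparing two iterates of the loop
    with the same linear part shows that a multiple of t w is in the lattice. *)
Lemma unfolds_loop n zz : unfolds_to n zz zz -> rational zz.2.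
Proof.
case: zz => [x w] [g [t [Hg t0 /= E L]]].
pose G k := iter k (mulmx g) 1%:M.
have GH k : hexsym (G k) by elim: k => [|k IH] /=; [exact: hexsym1|exact: hexsymM].
have GL k : lat n (G k *m x - x - (k%:R * t) *: w).
  elim: k => [|k IH]; first by rewrite /= mul1mx subrr mul0r scale0r subr0; apply: lat0.
  have L' : lat n (g *m (G k *m x - x - (k%:R * t) *: w)).
    by apply: hexmap_lat IH; case: Hg.
  have := latD L L'; rewrite /= !mulmxBr -scalemxAr -E mulmxA -/(G k.+1).
  by congr (lat n _); rewrite -natr1; apply: vec_ext; rewrite !cE; ring.
have [i [j [ij Gij]]] := pigeonhole hexsym_finite GH.
apply: (@lat_rational n w ((j - i)%:R * t)).
  by rewrite mulf_neq0 ?gt_eqF // ltr0n subn_gt0.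
have := latB (GL i) (GL j); rewrite Gij; congr (lat n _).
by rewrite natrB 1?ltnW //; apply: vec_ext; rewrite !cE; ring.
Qed.

(** A finite orbit has a loop, and a saddle joins two lattice points. *)
Lemma billiard_closed_rational n v : v != 0 -> billiard_closed n v -> rational v.
Proof.
move=> v0 B; have [x Kx Ix] := inward_ex n v0.
case: (B x Kx Ix) => [[orb [E0 oE fin]]|[m [j [orb [[jm oj] V0 oE [y hy Vy]]]]]].
  have [i [j [ij oij]]] := pigeonhole fin (fun k => ex_intro2 _ _ k I erefl).
  have U := unfolds_chain ij (fun k _ => oE k); rewrite -oij in U.
  have := unfolds_loop U; case: i {ij oij U} => [|i]; first by rewrite E0.
  by have := unfolds_chain (ltn0Sn i) (fun k _ => oE k) => /unfolds_rational <-; rewrite E0.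
have [t [t0 yE _ _]] := hy.
have Um : unfolds_to n (orb m) (y, (orb m).2).
  exists 1%:M, t; split; [exact: hexsym1|by []|by rewrite mul1mx|].
  by rewrite /= mul1mx yE addlK subrr; apply: lat0.
have U : unfolds_to n (orb 0%N) (y, (orb m).2).
  case: (posnP m) Um => [->//|m0]; apply: unfolds_trans; exact: unfolds_chain.
have r0 : rational (orb 0%N).2.
  have [g [t' [[_ Hg _] t'0 _ L]]] := U.
  apply: (@lat_rational n _ t'); first by rewrite gt_eqF.
  have := latB (latB (hexmap_lat Hg (vertex_lat Vy)) (vertex_lat V0)) L.
  by rewrite subKr.
case: (posnP j) oj => [->|j0] oj; first by move: r0; rewrite oj.
have /unfolds_rational H : unfolds_to n (orb 0%N) (orb j).
  by apply: unfolds_chain => // k kj; apply: oE; apply: leq_trans jm.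
by move: r0; rewrite H oj.
Qed.

End ClosedRational.

Lemma unit_circle_neq0 (R : realType) (v : 'cV[R]_2) : unit_circle v -> v != 0.
Proof.
move=> U; apply/eqP => v0; move: U; rewrite /unit_circle /= v0 dotE !cE mul0r addr0.
by move/esym/eqP; rewrite oner_eq0.
Qed.

Theorem theorem4p1 (R : realType) :
  (forall v : 'cV[R]_2, unit_circle v ->
     (geodesic_flow_closed 0 v <-> forall n : nat, geodesic_flow_closed n v)) /\
  (forall n : nat,
     [set v : 'cV[R]_2 | unit_circle v /\ billiard_closed n v] =
     [set v : 'cV[R]_2 | unit_circle v /\ billiard_closed 0 v]).
Proof.
split=> [v /unit_circle_neq0 v0|n].
  split=> [/(geodesic_closed_rational v0) rv n|H]; last exact: H.
  exact: rational_geodesic_closed.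
apply/seteqP; split=> v /= [U /(billiard_closed_rational (unit_circle_neq0 U)) rv];
  by split=> //; apply: rational_billiard_closed => //; apply: unit_circle_neq0.
Qed.
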